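(* Let $K_3$ be the universal positive constant described in the context. There exist universal positive constants $D, K_1, K_2$ such that the following holds. Let $p,n,s\in\mathbb{N}$, set $d = \nu_{\mathcal{H}} \vee \lceil D\rceil$, and suppose $1 \leq s < \sqrt{p}$ and $\log\left(1+\frac{p}{s^2}\right) \geq K_3^2 d$. Set $$\tau(p,s,n)^2 = \frac{s\log\left(1+\frac{p}{s^2}\right)}{n}.$$ If $\eta\in(0,1)$, then there exists $C_\eta>0$ depending only on $\eta$ such that for all $C > C_\eta$ we have $$P_0\left\{T_r(d) > C K_1 n\,\tau(p,s,n)^2\right\} + \sup_{\substack{f\in\mathcal{F}_s, \\ \|f\|_2 \geq C\tau(p,s,n)}} P_f\left\{T_r(d) \leq C K_1 n\,\tau(p,s,n)^2\right\} \leq \eta,$$ where $r = K_2\sqrt{\log\left(1+\frac{p}{s^2}\right)}$.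
   Context: Notation: $[p]=\{1,\dots,p\}$, $a\vee b=\max\{a,b\}$. A universal constant is an absolute constant not depending on any problem parameter. Model: one observes the $p$-dimensional Gaussian white noise model $dY_x = f(x)\,dx + \frac{1}{\sqrt n}\,dB_x$, $x\in[0,1]^p$. $P_f$ denotes the law of the observation when the signal is $f$, and $P_0$ the law when $f\equiv 0$. $\|\cdot\|_2$ is the $L^2([0,1]^p)$ norm. Function space: $\mathcal{H}\subset L^2([0,1])$ is a reproducing kernel Hilbert space (RKHS) whose kernel admits a Mercer expansion. Let $\mathbf 1$ be the constant function one and $\mathcal{H}_0 := \mathcal{H}\cap \mathrm{span}\{\mathbf 1\}^\perp$ (orthogonality in $L^2([0,1])$), also an RKHS, with eigenfunctions $\{\psi_k\}_{k\ge1}$ orthonormal in $L^2([0,1])$ and corresponding eigenvalues $\mu_1\ge\mu_2\ge\dots\ge0$ in the Mercer expansion of its kernel, so that $\|g\|_{\mathcal{H}_0}^2=\sum_{k\ge1}\mu_k^{-1}\langle g,\psi_k\rangle_{L^2}^2$. It is assumed that $\mu_1=1$. Parameter space: for $S\subset[p]$, $\mathcal{H}_S := \{f(x)=\sum_{j\in S} f_j(x_j): f_j\in\mathcal{H}_0,\ \|f_j\|_{\mathcal{H}_0}\le 1 \text{ for all } j\in S\}$, and $\mathcal{F}_s := \bigcup_{S\subset[p],\,|S|\le s}\mathcal{H}_S$. Truncation level: $\nu_{\mathcal{H}}=\nu_{\mathcal{H}}(p,s,n)$ is the smallest positive integer $\nu$ with $\mu_\nu \le \frac{\sqrt{\nu\log(1+p/s^2)}}{n}$.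 Test statistic: for $k\in\mathbb{N}$, $j\in[p]$ let $X_{k,j} := \int_{[0,1]^p}\psi_k(x_j)\,dY_x$; under $P_f$ these are independent with $X_{k,j}\sim N(\theta_{k,j}, n^{-1})$, $\theta_{k,j}=\int_0^1\psi_k(t)f_j(t)\,dt$. For $d\in\mathbb{N}$ and $r\ge0$, let $E_j(d):= n\sum_{k\le d}X_{k,j}^2$, $$T_r(d) := \sum_{j=1}^p (E_j(d)-\alpha_r(d))\mathbbm{1}_{\{E_j(d)\ge d+r^2\}},\qquad \alpha_r(d):=\frac{E\left(\|g\|^2\mathbbm{1}_{\{\|g\|^2\ge d+r^2\}}\right)}{P\{\|g\|^2\ge d+r^2\}},\quad g\sim N(0,I_d).$$ The constant $K_3$: $K_3>0$ is a universal constant for which the following companion ''bulk regime'' result holds. There are universal constants $D',K_1',K_2'>0$ such that, whenever $1\le s<\sqrt p$, $d'=\nu_{\mathcal{H}}\vee\lceil D'\rceil$, $\log(1+p/s^2)\le K_3^2 d'$, and with $\tau'^2 := \frac{s}{n}\sqrt{\nu_{\mathcal{H}}\log(1+p/s^2)}$ and $r'=K_2'(d'\log(1+p/s^2))^{1/4}$: for every $\eta\in(0,1)$ there is $C'_\eta>0$ depending only on $\eta$ with $P_0\{T_{r'}(d')>CK_1'n\tau'^2\}+\sup_{f\in\mathcal{F}_s,\|f\|_2\ge C\tau'}P_f\{T_{r'}(d')\le CK_1'n\tau'^2\}\le\eta$ for all $C>C'_\eta$. *)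

(* Defs.v *)
From HB Require Import structures.
From mathcomp Require Import all_boot all_order all_algebra.
From mathcomp Require Import all_classical all_reals all_analysis.

Set Implicit Arguments.
Unset Strict Implicit.
Unset Printing Implicit Defensive.

Import Order.TTheory GRing.Theory Num.Theory.
Import numFieldNormedType.Exports.

Local Open Scope classical_set_scope.
Local Open Scope ring_scope.

Section ProductProbability.
Context {d : measure_display} {T : measurableType d} {R : realType}.

Definition tuple_cons (n : nat) (z : T * n.-tuple T) : n.+1.-tuple T :=
  [the n.+1.-tuple T of z.1 :: z.2].

Lemma measurable_tuple_cons (n : nat) : measurable_fun setT (@tuple_cons n).
Proof. exact: measurable_cons measurable_fst measurable_snd. Qed.

HB.instance Definition _ (n : nat) :=
  isMeasurableFun.Build _ _ _ _ (@tuple_cons n) (@measurable_tuple_cons n).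

(* The [n]-fold product [P \x ... \x P], transported to tuples. *)
Fixpoint iid_prob (P : probability T R) (n : nat) :
    probability (n.-tuple T) R :=
  match n with
  | 0%N => dirac (nil_tuple T)
  | m.+1 => distribution (product_measure1 P (iid_prob P m)) (@tuple_cons m)
  end.

End ProductProbability.

Section L2.
Context {d : measure_display} {T : measurableType d} {R : realType}.
Variable P : probability T R.

Definition L2fun (f : T -> R) : Prop :=
  measurable_fun setT f /\ P.-integrable setT (fun x => (f x ^+ 2)%:E).

Definition dotL2 (f g : T -> R) : R := Rintegral P setT (fun x => f x * g x).

Definition normL2 (f : T -> R) : R := Num.sqrt (dotL2 f f).

Definition orthonormal (I : eqType) (phi : I -> T -> R) : Prop :=
  (forall i, L2fun (phi i)) /\
  (forall i j, dotL2 (phi i) (phi j) = (i == j)%:R).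

Definition mutually_independent (m : nat) (X : 'I_m -> T -> R) : Prop :=
  forall A : 'I_m -> set R, (forall i, measurable (A i)) ->
    P [set w | forall i, A i (X i w)] = (\prod_(i < m) P (X i @^-1` A i))%E.

End L2.

(* Lebesgue measure on [0,1] and on [0,1]^p, as probability measures carried by
   R and R^p: functions on [0,1] are represented by functions on R, whose
   values outside [0,1] play no role. *)
Definition unit_interval (R : realType) : probability (measurableTypeR R) R :=
  uniform_prob (@ltr01 R).

Definition unit_cube (R : realType) (p : nat) :
    probability (p.-tuple (measurableTypeR R)) R :=
  iid_prob (unit_interval R) p.

Section RKHS.
Context {R : realType}.
Implicit Types (H : set (R -> R)) (ip : (R -> R) -> (R -> R) -> R).

(* [H] is a Hilbert space of functions on [0,1] with inner product [ip] and
   reproducing kernel [K]. *)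
Record is_rkhs H ip (K : R -> R -> R) : Prop := IsRKHS {
  rkhs_zero : H (fun _ => 0);
  rkhs_comb : forall (a b : R) g h, H g -> H h ->
    H (fun x => a * g x + b * h x);
  rkhs_linear : forall (a b : R) g h u, H g -> H h -> H u ->
    ip (fun x => a * g x + b * h x) u = a * ip g u + b * ip h u;
  rkhs_sym : forall g h, H g -> H h -> ip g h = ip h g;
  rkhs_ge0 : forall g, H g -> 0 <= ip g g;
  rkhs_definite : forall g, H g -> ip g g = 0 ->
    forall x, x \in `[0, 1] -> g x = 0;
  rkhs_complete : forall u : nat -> R -> R, (forall i, H (u i)) ->
    (forall e : R, 0 < e -> exists N, forall i j, (N <= i)%N -> (N <= j)%N ->
       ip (fun x => u i x - u j x) (fun x => u i x - u j x) < e) ->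
    exists2 g, H g &
      (fun i => ip (fun x => u i x - g x) (fun x => u i x - g x)) @ \oo --> 0;
  rkhs_kernel : forall x, x \in `[0, 1] -> H (K x);
  rkhs_reproducing : forall g x, H g -> x \in `[0, 1] -> ip g (K x) = g x }.

(* Sequences of eigenvalues and eigenfunctions are indexed from 0 here: the
   usual [mu_k], [psi_k] with k >= 1 are [mu k.-1], [psi k.-1]. *)
Record mercer_expansion (K : R -> R -> R) (mu : nat -> R)
    (psi : nat -> R -> R) : Prop := MercerExpansion {
  mercer_orthonormal : orthonormal (unit_interval R) psi;
  mercer_ge0 : forall k, 0 <= mu k;
  mercer_noninc : forall k, mu k.+1 <= mu k;
  mercer_eigen : forall k x, x \in `[0, 1] ->
    dotL2 (unit_interval R) (K x) (psi k) = mu k * psi k x;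
  mercer_sum : forall x y, x \in `[0, 1] -> y \in `[0, 1] ->
    series (fun k => mu k * psi k x * psi k y) @ \oo --> K x y }.

(* H_0, the elements of [H] orthogonal to the constants; its inner product is
   that of [H]. *)
Definition centered H : set (R -> R) :=
  [set g | H g /\ dotL2 (unit_interval R) g (fun _ => 1) = 0].

(* [H] is an RKHS in L^2([0,1]) whose kernel has a Mercer expansion, and
   [mu], [psi] come from the Mercer expansion of the kernel of H_0.
   [model_orth1] only adds information for the eigenvalue 0: if H_0 has finite
   rank, the sequence [psi] continues with functions orthogonal to constants.
   In [model_norm], [ip g g] is the sum of the [<g, psi k>^2 / mu k], with
   [model_null] giving the meaning of the terms 0 / 0, which are 0. *)
Record rkhs_model H ip (mu : nat -> R) (psi : nat -> R -> R) : Prop :=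
    RKHSModel {
  model_L2 : forall g, H g -> L2fun (unit_interval R) g;
  model_H : exists K lam phi, is_rkhs H ip K /\ mercer_expansion K lam phi;
  model_H0 : exists K0, is_rkhs (centered H) ip K0 /\
    mercer_expansion K0 mu psi;
  model_orth1 : forall k, dotL2 (unit_interval R) (psi k) (fun _ => 1) = 0;
  model_null : forall g k, centered H g -> mu k = 0 ->
    dotL2 (unit_interval R) g (psi k) = 0;
  model_norm : forall g, centered H g ->
    series (fun k => (mu k)^-1 * dotL2 (unit_interval R) g (psi k) ^+ 2) @ \oo
      --> ip g g;
  model_mu1 : mu 0%N = 1 }.

Definition additive_class (p : nat) H ip (S : {set 'I_p}) :
    set (p.-tuple R -> R) :=
  [set f | exists g : 'I_p -> R -> R,
     (forall j, j \in S ->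
        centered H (g j) /\ Num.sqrt (ip (g j) (g j)) <= 1) /\
     f = (fun x => \sum_(j in S) g j (tnth x j))].

Definition sparse_class (p s : nat) H ip : set (p.-tuple R -> R) :=
  \bigcup_(S in [set S : {set 'I_p} | (#|S| <= s)%N]) additive_class H ip S.

Definition log_factor (p s : nat) : R := ln (1 + p%:R / s%:R ^+ 2).

Definition is_truncation_level (mu : nat -> R) (p s n nu : nat) : Prop :=
  let ok m := (0 < m)%N /\
    mu m.-1 <= Num.sqrt (m%:R * log_factor p s) / n%:R in
  ok nu /\ forall m, ok m -> (nu <= m)%N.

End RKHS.

Section WhiteNoise.
Context {d : measure_display} {Omega : measurableType d} {R : realType}.
Context (P : probability Omega R) {p : nat}.

(* Gaussian white noise [phi |-> \int phi dB] on [0,1]^p: the standard Gaussian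
   linear process indexed by L^2([0,1]^p). *)
Record is_white_noise (W : (p.-tuple R -> R) -> {RV P >-> R}) : Prop :=
    IsWhiteNoise {
  noise_linear : forall (a b : R) (phi chi : p.-tuple R -> R),
    L2fun (unit_cube R p) phi -> L2fun (unit_cube R p) chi ->
    {ae P, forall w,
      W (fun x => a * phi x + b * chi x) w = a * W phi w + b * W chi w};
  noise_normal : forall phi : p.-tuple R -> R,
    L2fun (unit_cube R p) phi -> normL2 (unit_cube R p) phi = 1 ->
    forall A : set R, measurable A -> P (W phi @^-1` A) = normal_prob 0 1 A;
  noise_independent : forall (m : nat) (phi : 'I_m -> p.-tuple R -> R),
    orthonormal (unit_cube R p) phi ->
    mutually_independent P (fun i => W (phi i)) }.

(* The observation [phi |-> \int phi dY] for dY = f dx + n^(-1/2) dB, at the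
   outcome [w].  P_f is the law of this process. *)
Definition observation (W : (p.-tuple R -> R) -> {RV P >-> R}) (n : nat)
    (f : p.-tuple R -> R) (w : Omega) : (p.-tuple R -> R) -> R :=
  fun phi => dotL2 (unit_cube R p) f phi + (Num.sqrt n%:R)^-1 * W phi w.

End WhiteNoise.

Section Test.
Context {R : realType}.

Definition sqnorm (d : nat) (z : d.-tuple R) : R := \sum_(i < d) tnth z i ^+ 2.

Definition std_gauss (d : nat) : probability (d.-tuple (measurableTypeR R)) R :=
  iid_prob (normal_prob 0 1 : probability (measurableTypeR R) R) d.

Definition alpha (r : R) (d : nat) : R :=
  let A := [set z : d.-tuple R | d%:R + r ^+ 2 <= sqnorm z] in
  fine ('E_(std_gauss d)[(fun z : d.-tuple R => sqnorm z * \1_A z)])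
    / fine (std_gauss d A).

Section Statistic.
Context {p : nat} (psi : nat -> R -> R) (n : nat).
Implicit Type y : (p.-tuple R -> R) -> R.

Definition coeff y (k : nat) (j : 'I_p) : R := y (fun x => psi k (tnth x j)).

Definition energy y (d : nat) (j : 'I_p) : R :=
  n%:R * \sum_(k < d) coeff y k j ^+ 2.

Definition statistic (r : R) (d : nat) y : R :=
  \sum_(j < p) (energy y d j - alpha r d) *
    (d%:R + r ^+ 2 <= energy y d j)%R%:R.

End Statistic.

(* Supremum of a set of probabilities, 0 if the set is empty. *)
Definition sup_prob (A : set (\bar R)) : \bar R :=
  ereal_sup ([set 0%E] `|` A).

(* P_0{T_r(d) > t} + sup of P_f{T_r(d) <= t} over f in F_s, ||f||_2 >= rho. *)
Definition testing_error {disp : measure_display} {Omega : measurableType disp}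
    (P : probability Omega R) (p s n : nat) (H : set (R -> R))
    (ip : (R -> R) -> (R -> R) -> R) (psi : nat -> R -> R)
    (W : (p.-tuple R -> R) -> {RV P >-> R})
    (r : R) (d : nat) (t rho : R) : \bar R :=
  (P [set w | (t < statistic psi n r d (observation W n (fun _ => 0) w))%R] +
   sup_prob
     [set P [set w | (statistic psi n r d (observation W n f w) <= t)%R]
       | f in [set f | sparse_class s H ip f /\
                       (rho <= normL2 (unit_cube R p) f)%R]])%E.

End Test.

(* The bulk regime property characterizing the constant [K3]. *)
Definition bulk_regime (R : realType) (K3 : R) : Prop :=
  exists D K1 K2 : R, [/\ 0 < D, 0 < K1 & 0 < K2] /\
  forall eta : R, 0 < eta < 1 ->
  exists2 Ceta : R, 0 < Ceta &
  forall (H : set (R -> R)) (ip : (R -> R) -> (R -> R) -> R)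
    (mu : nat -> R) (psi : nat -> R -> R),
  rkhs_model H ip mu psi ->
  forall p n s nu : nat,
  (0 < n)%N -> (1 <= s)%N -> (s%:R : R) < Num.sqrt p%:R ->
  is_truncation_level mu p s n nu ->
  let d := maxn nu `|Num.ceil D|%N in
  log_factor p s <= K3 ^+ 2 * d%:R ->
  let tau :=
    Num.sqrt (s%:R / n%:R * Num.sqrt (nu%:R * log_factor p s)) : R in
  let r := K2 * (d%:R * log_factor p s) `^ (4%:R^-1) in
  forall (disp : measure_display) (Omega : measurableType disp)
    (P : probability Omega R) (W : (p.-tuple R -> R) -> {RV P >-> R}),
  is_white_noise W ->
  forall C : R, Ceta < C ->
  (testing_error s n H ip psi W r d
     (C * K1 * n%:R * tau ^+ 2) (C * tau) <= eta%:E)%E.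

(* Main.v *)
From HB Require Import structures.
Require Import Defs.
From mathcomp Require Import all_boot all_order all_algebra.
From mathcomp Require Import all_classical all_reals all_analysis.
From mathcomp Require Import measurable_realfun.
From mathcomp Require Import ring lra.

(** Write L = log(1+p/s^2).  The assumption on the dimension says d <= kappa L
with kappa = K3^-2, so the cutoff r = K2 sqrt L, with K2^2 = 8 (1 + kappa),
satisfies r^2 >= 8 d: the threshold t = d + r^2 lies far out in the tail of the
chi-square law with d degrees of freedom, where crude exponential moments are
as good as sharp tail estimates.  One may take D = K1 = 1.

Testing the functions psi_k(x_j), which are orthonormal on the cube, against
the observation turns the problem into a Gaussian sequence model: the energies
become |a_j + z_j|^2, where z_1, ..., z_p are independent standard Gaussian
vectors of dimension d and a_j is sqrt n times the vector of the first d
coefficients of f_j [statistic_law].  The statistic is the sum over j of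
h(|a_j + z_j|^2), where h(x) = (x - alpha) 1(x >= t) [excess].

Noise.  By the choice of alpha the variables h(|z_j|^2) are centered
[excess_mean]; their second moment is at most 256 exp(d - t/8) <= 256 exp(-L)
by Chernoff's method, because E exp(g^2/4) <= e in each coordinate
[excess_sqr_le].  Since p exp(-L) <= s^2 [expR_log_factor_le], Chebyshev's
inequality bounds by O(1/C^2) the probability that the sum of the h(|z_j|^2)
over any set of indices exceeds C n tau^2 = C s L [noise_excess_tail].  This is
the type I error, and it also controls the coordinates outside the support of
the signal.

Signal.  On the support S one uses h(x) >= x - max(alpha, t), where both t and
alpha are O(L) [alpha_le], together with |a + z|^2 >= |a|^2/2 - |z|^2.  The sum
of |z_j|^2 over S has mean O(s d) = O(s L), so Markov's inequality applies
[noise_energy_tail], and what remains is to see that the a_j carry almost all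
of n |f|^2 >= C^2 s L.  Polarizing the formula for the norm of H_0 and using the
reproducing property, every g in H_0 is the pointwise sum of its expansion in
the psi_k [mercer_pointwise]; Fatou's lemma then shows that truncation loses at
most the next eigenvalue when g is in the unit ball [norm_le_coefs], and the
choice of the truncation level makes this eigenvalue at most L / (K3 n)
[truncated_eigenvalue_le].  Hence the signal is of order C^2 s L while every
other contribution is of order at most C s L, and a large C wins
[detection_constP]. *)

Set Implicit Arguments.
Unset Strict Implicit.
Unset Printing Implicit Defensive.

Import Order.TTheory GRing.Theory Num.Theory.
Import numFieldNormedType.Exports.

Local Open Scope classical_set_scope.
Local Open Scope ring_scope.

(** * Laws and integrals under product probabilities *)

(** Equality of laws is only asked on measurable sets, which is all that
integrals see. *)
Definition has_law {d d'} {T : measurableType d} {T' : measurableType d'}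
    {R : realType} (P : probability T R) (X : T -> T')
    (Q : probability T' R) : Prop :=
  measurable_fun setT X /\ forall A, measurable A -> P (X @^-1` A) = Q A.

Section Law.
Context {d d'} {T : measurableType d} {T' : measurableType d'} {R : realType}.
Variables (P : probability T R) (X : T -> T') (Q : probability T' R).
Hypothesis XQ : has_law P X Q.

Let mX : measurable_fun setT X. Proof. by case: XQ. Qed.

Lemma law_ge0_integral (f : T' -> \bar R) : measurable_fun setT f ->
  (forall y, 0 <= f y)%E -> (\int[P]_x f (X x) = \int[Q]_y f y)%E.
Proof.
move=> mf f0; transitivity (\int[pushforward P X]_y f y)%E.
  by rewrite ge0_integral_pushforward.
by apply: eq_measure_integral => A mA _; case: XQ => _ /(_ A mA).
Qed.

Lemma law_integrable (f : T' -> \bar R) : Q.-integrable setT f ->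
  P.-integrable setT (f \o X).
Proof.
move=> /integrableP[mf fi]; apply/integrableP; split.
  exact: measurableT_comp mf mX.
rewrite (@law_ge0_integral (fun y => `|f y|%E))//.
exact: measurableT_comp.
Qed.

Lemma law_integral (f : T' -> \bar R) : Q.-integrable setT f ->
  (\int[P]_x f (X x) = \int[Q]_y f y)%E.
Proof.
move=> fi; have mf := measurable_int _ fi.
transitivity (\int[pushforward P X]_y f y)%E.
  by rewrite integral_pushforward//; exact: law_integrable.
by apply: eq_measure_integral => A mA _; case: XQ => _ /(_ A mA).
Qed.

Lemma law_Rintegral (f : T' -> R) : Q.-integrable setT (EFin \o f) ->
  \int[P]_x f (X x) = \int[Q]_y f y.
Proof. by move=> fi; rewrite /Rintegral (law_integral fi). Qed.

End Law.

Section ProductIntegral.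
Context {d d'} {T : measurableType d} {T' : measurableType d'} {R : realType}.
Variables (P : probability T R) (Q : probability T' R).

Lemma integrable_tensor (u : T -> R) (v : T' -> R) :
  P.-integrable setT (EFin \o u) -> Q.-integrable setT (EFin \o v) ->
  (P \x Q)%E.-integrable setT (EFin \o (fun z => u z.1 * v z.2)).
Proof.
move=> ui vi.
have mu := measurable_int _ ui; have mv := measurable_int _ vi.
have muv : measurable_fun setT (EFin \o (fun z : T * T' => u z.1 * v z.2)%R).
  apply/measurable_EFinP/measurable_funM.
    by apply: measurableT_comp => //; exact/measurable_EFinP.
  by apply: measurableT_comp => //; exact/measurable_EFinP.
apply/(integrable12ltyP _ _ muv).
have [/integrableP[_ ui'] /integrableP[_ vi']] := (ui, vi).
under eq_integral => x _.
  under eq_integral do rewrite /= normrM EFinM.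
  rewrite ge0_integralZl//=; last first.
    by do 2 apply: measurableT_comp => //; exact/measurable_EFinP.
  over.
rewrite ge0_integralZr//=; last 2 first.
- by do 2 apply: measurableT_comp => //; exact/measurable_EFinP.
- exact: integral_ge0.
apply: lte_mul_pinfty => //; first exact: integral_ge0.
by rewrite ge0_fin_numE//; exact: integral_ge0.
Qed.

Lemma Rintegral_tensor (u : T -> R) (v : T' -> R) :
  P.-integrable setT (EFin \o u) -> Q.-integrable setT (EFin \o v) ->
  \int[(P \x Q)%E]_z (u z.1 * v z.2) = \int[P]_x u x * \int[Q]_y v y.
Proof.
move=> ui vi; have uvi := integrable_tensor ui vi.
rewrite /Rintegral -integral12_prod_meas1//=.
rewrite -fineM; try exact: integrable_fin_num.
congr fine; rewrite /fubini_F.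
under eq_integral => x _.
  under eq_integral do rewrite /= EFinM.
  rewrite integralZl//; over.
rewrite /= -[X in (_ * X)%E]fineK; last exact: integrable_fin_num.
by rewrite -integralZr// fineK//; exact: integrable_fin_num.
Qed.

End ProductIntegral.

Section IID.
Context {d : measure_display} {T : measurableType d} {R : realType}.
Implicit Types P : probability T R.

Definition box n (A : 'I_n -> set T) : set (n.-tuple T) :=
  [set z | forall i, A i (tnth z i)].

Lemma boxE n (A : 'I_n -> set T) :
  box A = \bigcap_(i in [set: 'I_n]) (fun z => tnth z i) @^-1` A i.
Proof. by apply/seteqP; split=> z /= Az i => [_|]; exact: Az. Qed.

Lemma measurable_box n (A : 'I_n -> set T) :
  (forall i, measurable (A i)) -> measurable (box A).
Proof.
move=> mA; rewrite boxE; apply: fin_bigcap_measurable => // i _.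
by rewrite -[X in measurable X]setTI; exact: measurable_tnth.
Qed.

Lemma iid_prob_box P n (A : 'I_n -> set T) : (forall i, measurable (A i)) ->
  iid_prob P n (box A) = (\prod_(i < n) P (A i))%E.
Proof.
elim: n A => [|n IH] A mA /=.
  by rewrite big_ord0 diracE mem_set// => -[].
rewrite big_ord_recl -IH; last by move=> i; exact: mA.
rewrite -product_measure1E//; last by apply: measurable_box => i; exact: mA.
rewrite /distribution /pushforward/=; congr (product_measure1 _ _ _).
apply/seteqP; split => [[x z] /= Az|[x z] [/= Ax Az]].
  split; first exact: (Az ord0).
  by move=> i; have := Az (lift ord0 i); rewrite tnthS.
move=> i; case: (unliftP ord0 i) => [j ->|->]; first by rewrite tnthS; exact: Az.
exact: Ax.
Qed.

Definition boxes n (G : set (set T)) : set (set (n.-tuple T)) :=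
  [set box A | A in [set A : 'I_n -> set T | forall i, G (A i)]].

Lemma boxes_setI n (G : set (set T)) : setI_closed G ->
  setI_closed (@boxes n G).
Proof.
move=> GI _ _ [A GA <-] [B GB <-]; exists (fun i => A i `&` B i).
  by move=> i; exact: GI.
apply/seteqP; split=> z /=.
  by move=> ABz; split=> i; have [] := ABz i.
by move=> [Az Bz] i.
Qed.

Lemma boxes_setT n (G : set (set T)) : G setT -> @boxes n G setT.
Proof. by move=> GT; exists (fun=> setT) => //; apply/seteqP; split. Qed.

(** Each coordinate preimage of a set of G is a box whose other sides are the
whole space; this is why G has to contain the whole space. *)
Lemma measurable_boxes n (G : set (set T)) : measurable = <<s G >> ->
  G setT -> measurable = <<s @boxes n G >>.
Proof.
move=> GE GT.
have Gm A : G A -> measurable A by rewrite GE; exact: sub_sigma_algebra.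
apply/seteqP; split.
- apply: smallest_sub; first exact: smallest_sigma_algebra.
  rewrite -bigcup_seq; apply: bigcup_sub => i _ _ [D mD <-].
  have : preimage_set_system setT
      (fun z : n.-tuple T => tnth z i) (<<s G >>) `<=` <<s @boxes n G >>.
    have -> : <<s G >> = G.-sigma.-measurable by [].
    rewrite -g_sigma_preimageE; apply: smallest_sub.
      exact: smallest_sigma_algebra.
    move=> _ [A GA <-]; apply: sub_sigma_algebra.
    exists (fun k => if k == i then A else setT).
      by move=> k /=; case: ifP.
    apply/seteqP; split=> z /=.
      by move=> /(_ i); rewrite eqxx.
    by move=> [_ Az] k; case: eqP => [->|].
  by apply; exists D => //; rewrite -GE.
- apply: smallest_sub; first exact: sigma_algebra_measurable.
  by move=> _ [A GA <-]; apply: measurable_box => i; exact: Gm.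
Qed.

(** The boxes with sides in a generating pi-system form themselves a
generating pi-system, so they determine the law. Allowing a general pi-system
lets the result be iterated: below it is applied to tuples of tuples, with
boxes as sides. *)
Lemma iid_prob_unique P n (G : set (set T)) (mu : probability (n.-tuple T) R) :
  measurable = <<s G >> -> setI_closed G -> G setT ->
  (forall A : 'I_n -> set T, (forall i, G (A i)) ->
     mu (box A) = (\prod_(i < n) P (A i))%E) ->
  forall B, measurable B -> mu B = iid_prob P n B.
Proof.
move=> GE GI GT muE B mB.
apply: (measure_unique (boxes G) (fun=> setT)) => //.
- exact: measurable_boxes.
- exact: boxes_setI.
- by move=> _; exact: boxes_setT.
- by rewrite bigcup_const.
- move=> _ [A GA <-]; apply: etrans (muE _ GA) (esym _).
  by apply: iid_prob_box => i; rewrite GE; exact: sub_sigma_algebra.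
- by move=> _; apply: le_lt_trans (probability_le1 _ _) _; rewrite ?ltry.
Qed.

Lemma iid_coord_law P n (i : 'I_n) :
  has_law (iid_prob P n) (fun z => tnth z i) P.
Proof.
split=> [|A mA]; first exact: measurable_tnth.
rewrite -[RHS](_ : (\prod_(k < n) P (if k == i then A else setT))%E = _).
  rewrite -iid_prob_box; last by move=> k; case: ifP.
  congr (iid_prob P n _); apply/seteqP; split=> z /=.
    by move=> Az k; case: eqP => [->|].
  by move=> /(_ i); rewrite eqxx.
rewrite (bigD1 i)//= eqxx big1 ?mule1// => k /negbTE ->.
exact: probability_setT.
Qed.

(** Pairs of distinct coordinates carry all the independence that second
moment computations need. *)
Lemma iid_coord2_law P n (i j : 'I_n) : i != j ->
  has_law (iid_prob P n) (fun z => (tnth z i, tnth z j)) (P \x P)%E.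
Proof.
move=> ij.
have mX : measurable_fun setT (fun z : n.-tuple T => (tnth z i, tnth z j)).
  by apply: measurable_fun_pair; exact: measurable_tnth.
split=> // D mD.
pose Xm : {mfun n.-tuple T >-> (T * T)%type} :=
  HB.pack (fun z : n.-tuple T => (tnth z i, tnth z j))
    (isMeasurableFun.Build _ _ _ _ _ mX).
apply/esym/(product_measure_unique (m' := distribution (iid_prob P n) Xm)) => //.
move=> A B mA mB.
pose S k := if k == i then A else if k == j then B else setT.
rewrite -[RHS](_ : (\prod_(k < n) P (S k))%E = _).
  rewrite -iid_prob_box; last by move=> k; rewrite /S; do 2 case: ifP => //.
  rewrite /distribution /pushforward; congr (iid_prob P n _).
  apply/seteqP; split=> z /=.
    move=> [/= Az Bz] k; rewrite /S.
    by case: eqP => [->//|_]; case: eqP => [->|].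
  move=> Sz; split; first by have := Sz i; rewrite /S eqxx.
  by have := Sz j; rewrite /S eqxx eq_sym (negbTE ij).
rewrite (bigD1 i)//= (bigD1 j) 1?eq_sym//= /S eqxx eq_sym (negbTE ij) eqxx.
rewrite big1 ?mule1// => k /andP[/negbTE-> /negbTE->].
exact: probability_setT.
Qed.

Lemma ge0_integral_iid_prod P (v : T -> R) n : measurable_fun setT v ->
  (forall x, 0 <= v x) ->
  (\int[iid_prob P n]_z (\prod_(i < n) v (tnth z i))%:E
   = (\int[P]_x (v x)%:E) ^+ n)%E.
Proof.
move=> mv v0.
have mprod m : measurable_fun setT
    (fun z : m.-tuple T => (\prod_(i < m) v (tnth z i))%:E).
  apply/measurable_EFinP/measurable_prod => i _.
  by apply: measurableT_comp => //; exact: measurable_tnth.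
have prod0 m (z : m.-tuple T) : 0 <= \prod_(i < m) v (tnth z i).
  exact: prodr_ge0.
elim: n => [|n IH]; rewrite ?expeS /=.
  by rewrite integral_dirac ?diracT ?mul1e ?big_ord0//; exact: mprod.
rewrite (@ge0_integral_distribution _ _ _ _ _ _ (@tuple_cons _ _ n)
  (fun z => (\prod_(i < n.+1) v (tnth z i))%:E)); last 2 first.
- exact: mprod.
- by move=> z; rewrite lee_fin.
transitivity (\int[(P \x iid_prob P n)%E]_x
    ((v x.1)%:E * (\prod_(i < n) v (tnth x.2 i))%:E))%E.
  apply: eq_integral => -[x z] _; rewrite -EFinM /tuple_cons/= big_ord_recl/=.
  by congr (_ * _)%:E; apply: eq_bigr => i _; rewrite tnthS.
rewrite fubini_tonelli1/=; last 2 first.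
- apply: emeasurable_funM.
    by apply/measurable_EFinP; apply: measurableT_comp.
  exact: (measurableT_comp (mprod n) measurable_snd).
- by move=> x; rewrite -EFinM lee_fin mulr_ge0// prod0.
rewrite /fubini_F /=; under eq_integral => x _.
  rewrite ge0_integralZl//=; last 3 first.
  - exact: mprod.
  - by move=> z _; rewrite lee_fin prod0.
  - by rewrite lee_fin.
  rewrite IH; over.
rewrite ge0_integralZr//=; last 3 first.
- exact/measurable_EFinP.
- by move=> x _; rewrite lee_fin.
- by rewrite expe_ge0// integral_ge0// => x _; rewrite lee_fin.
Qed.

End IID.

Lemma measurable_mktuple {d d'} {T : measurableType d} {T' : measurableType d'}
    n (X : 'I_n -> T -> T') : (forall i, measurable_fun setT (X i)) ->
  measurable_fun setT (fun w => [tuple X i w | i < n]).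
Proof.
move=> mX; apply/measurable_fun_tnthP => i.
rewrite (_ : _ \o _ = X i); first exact: mX.
by apply/funext => w /=; rewrite tnth_mktuple.
Qed.

(** Grouping independent variables in blocks gives independent blocks. Boxes
of boxes generate the events on tuples of tuples, and on those the probability
factors into the scalar events. *)
Lemma iid_blocks_law {d d'} {Omega : measurableType d} {T : measurableType d'}
    {R : realType} (P : probability Omega R) (N : probability T R)
    (p n : nat) (Z : 'I_p -> 'I_n -> Omega -> T) :
  (forall j k, measurable_fun setT (Z j k)) ->
  (forall A : 'I_p -> 'I_n -> set T, (forall j k, measurable (A j k)) ->
    P [set w | forall j k, A j k (Z j k w)] =
    (\prod_(j < p) \prod_(k < n) N (A j k))%E) ->
  has_law P (fun w => [tuple [tuple Z j k w | k < n] | j < p])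
    (iid_prob (iid_prob N n) p).
Proof.
move=> mZ ZE.
have mX : measurable_fun setT
    (fun w => [tuple [tuple Z j k w | k < n] | j < p]).
  by apply: measurable_mktuple => j; exact: measurable_mktuple.
split=> // B mB.
pose X : {mfun Omega >-> p.-tuple (n.-tuple T)} :=
  HB.pack (fun w => [tuple [tuple Z j k w | k < n] | j < p])
    (isMeasurableFun.Build _ _ _ _ _ mX).
apply: (@iid_prob_unique _ _ _ (iid_prob N n) p (boxes measurable)
  (distribution P X)) => //.
- apply: measurable_boxes => //; apply/esym/sigma_algebra_id.
  exact: sigma_algebra_measurable.
- by apply: boxes_setI => A C mA mC; exact: measurableI.
- exact: boxes_setT.
move=> A GA; have {GA}[A' A'E] : {A' : 'I_p -> 'I_n -> set T & forall j : 'I_p,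
    (forall k, measurable (A' j k)) /\ box (A' j) = A j}.
  apply: (@choice _ _ (fun (j : 'I_p) (B : 'I_n -> set T) =>
    (forall k, measurable (B k)) /\ box B = A j)) => j.
  by have [B' mB' BE] := GA j; exists B'.
rewrite (_ : (\prod_(i < p) _)%E =
    (\prod_(j < p) \prod_(k < n) N (A' j k))%E); last first.
  apply: eq_bigr => j _; have [mA' <-] := A'E j.
  by rewrite iid_prob_box.
rewrite -ZE => [|j k]; last by have [] := A'E j.
rewrite /distribution /pushforward; congr (P _).
apply/seteqP; split=> w /=.
  move=> Aw j k; have := Aw j; have [_ <-] := A'E j => /(_ k).
  by rewrite !tnth_mktuple.
move=> Aw j; have [_ <-] := A'E j => k.
by rewrite !tnth_mktuple.
Qed.

(** Independence in the white noise is stated for families indexed by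
ordinals; the pairs (j, k) are therefore enumerated. *)
Lemma white_noise_law {disp} {Omega : measurableType disp} {R : realType}
    (P : probability Omega R) (p n : nat)
    (W : (p.-tuple R -> R) -> {RV P >-> R})
    (phi : 'I_p * 'I_n -> p.-tuple R -> R) :
  is_white_noise W -> Defs.orthonormal (unit_cube R p) phi ->
  has_law (T' := p.-tuple (n.-tuple (measurableTypeR R))) P
    (fun w => [tuple [tuple W (phi (j, k)) w | k < n] | j < p])
    (iid_prob (std_gauss n) p).
Proof.
move=> Wn [phiL2 phion].
apply: iid_blocks_law => [j k|A mA].
  by have := @measurable_funPT _ _ _ _ (W (phi (j, k))).
pose m := #|{: 'I_p * 'I_n}|.
pose B (i : 'I_m) := A (enum_val i).1 (enum_val i).2.
have onB : Defs.orthonormal (unit_cube R p) (fun i : 'I_m => phi (enum_val i)).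
  split=> [i|i j]; first exact: phiL2.
  by rewrite phion (inj_eq enum_val_inj).
have := noise_independent Wn onB (A := B) (fun i => mA _ _).
rewrite (_ : [set w | _] = [set w | forall j k, A j k (W (phi (j, k)) w)]);
    last first.
  apply/seteqP; split => w /= Aw.
    move=> j k; have := Aw (enum_rank (j, k)).
    by rewrite /B enum_rankK.
  by move=> i; rewrite /B; have := Aw (enum_val i).1 (enum_val i).2;
     rewrite -surjective_pairing.
move=> ->.
transitivity (\prod_(q : 'I_p * 'I_n) normal_prob 0 1 (A q.1 q.2))%E.
  rewrite [RHS](reindex  (fun i : 'I_m => enum_val i))/=; last first.
    by exists enum_rank => q _; [exact: enum_valK|exact: enum_rankK].
  apply: eq_bigr => i _; rewrite (noise_normal Wn) ?/B//; last exact: mA.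
  by rewrite /normL2 phion eqxx sqrtr1.
by rewrite pair_bigA/=.
Qed.

(** * Tails and exponential moments of Gaussian vectors *)

Section StandardNormal.
Context {R : realType}.
Local Notation mu := (@lebesgue_measure R).
Local Notation N01 := (normal_prob (0 : R) 1).

(** The Gaussian law is given as a set function with a density, so its Radon-
Nikodym derivative agrees almost everywhere with that density. *)
Lemma normal_ge0_integral (f : R -> R) : measurable_fun setT f ->
  (forall x, 0 <= f x) ->
  (\int[N01]_x (f x)%:E = \int[mu]_x (f x * normal_pdf 0 1 x)%:E)%E.
Proof.
move=> mf f0.
have dom := normal_prob_dominates (0 : R) 1.
have mpdf := @measurable_normal_pdf R 0 1.
rewrite -(Radon_Nikodym_SigmaFinite.change_of_variables dom)//;
  last exact/measurable_EFinP.
have mRN := measurable_int _ (Radon_Nikodym_SigmaFinite.f_integrable dom).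
transitivity (\int[mu]_x ((f x)%:E * (normal_pdf 0 1 x)%:E))%E; last first.
  by apply: eq_integral => x _; rewrite EFinM.
apply: ae_eq_integral => //.
- by apply: emeasurable_funM => //; exact/measurable_EFinP.
- by apply: emeasurable_funM; exact/measurable_EFinP.
- apply: (@ae_eqe_mul2l _ _ _ mu setT) => //.
  apply: integral_ae_eq => //.
  + exact: Radon_Nikodym_SigmaFinite.f_integrable.
  + exact/measurable_EFinP.
  + by move=> E _ mE; rewrite -Radon_Nikodym_SigmaFinite.f_integral.
Qed.

(** Up to the factor sqrt 2, the Gaussian density multiplied by exp(x^2/4) is
the density of the centered Gaussian law of variance 2; the exact value is
sqrt 2. *)
Lemma normal_exp_sqr_le2 : (\int[N01]_x (expR (x ^+ 2 / 4))%:E <= 2%:E)%E.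
Proof.
have s2 : Num.sqrt 2 != 0 :> R by rewrite sqrtr_eq0 -ltNge.
have m4 : measurable_fun setT (fun x : R => expR (x ^+ 2 / 4)).
  by apply: measurableT_comp => //; apply: measurable_funM => //;
     exact: measurable_funX.
rewrite (normal_ge0_integral m4) => [|x]; last exact: expR_ge0.
have -> : (fun x : R => (expR (x ^+ 2 / 4) * normal_pdf 0 1 x)%:E) =
    (fun x => (Num.sqrt 2)%:E * (normal_pdf 0 (Num.sqrt 2) x)%:E)%E.
  apply/funext => x; rewrite -EFinM; congr EFin.
  rewrite !normal_pdfE// /normal_fun subr0.
  rewrite mulrCA -expRD sqr_sqrtr//.
  rewrite [RHS]mulrA; congr (_ * expR _); last by field.
  rewrite /normal_peak sqr_sqrtr// expr1n mul1r -mulrnAr sqrtrM// invfM.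
  by rewrite mulVKf.
rewrite ge0_integralZl//=; last 2 first.
- by apply/measurable_EFinP; exact: measurable_normal_pdf.
- by move=> x _; rewrite lee_fin normal_pdf_ge0.
rewrite integral_normal_pdf mule1 lee_fin.
by rewrite -(@ler_pXn2r _ 2) ?nnegrE ?sqrtr_ge0// sqr_sqrtr//; lra.
Qed.

(** The constant of [normal_tail_ge]: on the unit interval that starts at sqrt
t one has x^2/2 <= t + 1. *)
Definition normal_tail_const : R := normal_peak (1 : R) * expR (-1).

Lemma normal_tail_const_gt0 : 0 < normal_tail_const.
Proof. by rewrite mulr_gt0 ?expR_gt0// normal_peak_gt0. Qed.

(** A crude lower bound, off by a factor 2 in the exponent: it only serves to
bound a conditional expectation from above, where the numerator can be made
smaller than any power of it. *)
Lemma normal_tail_ge (t : R) : 0 <= t ->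
  ((normal_tail_const * expR (- t))%:E <= N01 [set x | (t <= x ^+ 2)%R])%E.
Proof.
move=> t0; set a := Num.sqrt t.
have a0 : 0 <= a by exact: sqrtr_ge0.
have a2 : a ^+ 2 = t by rewrite sqr_sqrtr.
have mA : measurable [set x : R | t <= x ^+ 2].
  rewrite -[X in measurable X]setTI.
  by apply: measurable_fun_le => //; exact: measurable_funX.
apply: (@le_trans _ _ (N01 `[a, a + 1])); last first.
  apply: le_measure; rewrite ?inE// => x /=; rewrite in_itv/= => /andP[ax _].
  by rewrite -a2 lerXn2r// nnegrE (le_trans a0).
rewrite /normal_prob.
(* (a + 1)^2 <= 2 a^2 + 2, hence the exponent - t - 1. *)
apply: (@le_trans _ _
  (\int[mu]_(x in `[a, (a + 1)%R]) (normal_tail_const * expR (- t))%:E)%E).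
  rewrite integral_cst//= lebesgue_measure_itv/= lte_fin ltrDl ltr01.
  by rewrite -EFinD addrAC subrr add0r mule1.
apply: ge0_le_integral => //.
- by move=> x _; rewrite lee_fin mulr_ge0 ?expR_ge0// ltW// normal_tail_const_gt0.
- by apply/measurable_funTS/measurable_EFinP; exact: measurable_normal_pdf.
- move=> x /=; rewrite in_itv/= => /andP[ax xa]; rewrite lee_fin.
  rewrite normal_pdfE// /normal_tail_const -mulrA -expRD.
  rewrite ler_wpM2l ?normal_peak_ge0// /normal_fun ler_expR subr0 expr1n.
  have : x ^+ 2 <= (a + 1) ^+ 2.
    by rewrite lerXn2r// nnegrE ?(le_trans a0)//; lra.
  have := sqr_ge0 (a - 1); nra.
Qed.

End StandardNormal.

Section GaussianVector.
Context {R : realType} (d : nat).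
Local Notation Q := (std_gauss d : probability (d.-tuple (measurableTypeR R)) R).
Implicit Types (z : d.-tuple (measurableTypeR R)) (u : d.-tuple (measurableTypeR R) -> R).

Lemma sqnorm_ge0 z : 0 <= sqnorm z.
Proof. by apply: sumr_ge0 => i _; exact: sqr_ge0. Qed.

Lemma measurable_sqnorm :
  measurable_fun setT (fun z : d.-tuple (measurableTypeR R) => sqnorm z).
Proof.
apply: measurable_sum => i; apply: measurable_funX.
exact: (@measurable_tnth _ (measurableTypeR R)).
Qed.

Lemma std_gauss_exp_sqnorm :
  (\int[Q]_z (expR (sqnorm z / 4))%:E <= (expR d%:R)%:E)%E.
Proof.
rewrite (_ : (\int[Q]_z _)%E =
    (\int[Q]_z (\prod_(i < d) expR (tnth z i ^+ 2 / 4))%:E)%E); last first.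
  by apply: eq_integral => z _; rewrite -expR_sum -mulr_suml.
rewrite (@ge0_integral_iid_prod _ (measurableTypeR R) R _
  (fun x => expR (x ^+ 2 / 4))); last 2 first.
- by apply: measurableT_comp => //; apply: measurable_funM => //;
     exact: measurable_funX.
- by move=> x; exact: expR_ge0.
have e1 : (\int[normal_prob (0 : R) 1]_x (expR (x ^+ 2 / 4))%:E
    <= (expR 1)%:E)%E.
  apply: (le_trans normal_exp_sqr_le2); rewrite lee_fin.
  by rewrite (le_trans _ (expR_ge1Dx 1))//; lra.
have e0 : (0 <= \int[normal_prob (0 : R) 1]_x (expR (x ^+ 2 / 4))%:E)%E.
  by apply: integral_ge0 => x _; rewrite lee_fin expR_ge0.
move: e0 e1; case: (\int[_]_x _)%E => [x| |]//; rewrite !lee_fin => x0 x1.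
rewrite -EFin_expe lee_fin -[X in expR X]mulr1 expRM_natl.
by rewrite lerXn2r// nnegrE expR_ge0.
Qed.

(** Comparison with exp(|z|^2/4) settles integrability and size at once for
the truncated powers of |z|^2 that occur below. *)
Lemma std_gauss_dominated u c : measurable_fun setT u ->
  (forall z, `|u z| <= c * expR (sqnorm z / 4)) ->
  Q.-integrable setT (EFin \o u) /\ \int[Q]_z u z <= c * expR d%:R.
Proof.
move=> mu uc.
have c0 : 0 <= c.
  have z0 : d.-tuple (measurableTypeR R) := [tuple 0 | i < d].
  by have := le_trans (normr_ge0 _) (uc z0); rewrite pmulr_lge0 ?expR_gt0.
have me : measurable_fun setT (fun z : d.-tuple (measurableTypeR R) =>
    (expR (sqnorm z / 4))%:E).
  apply/measurable_EFinP/measurableT_comp => //; apply: measurable_funM => //.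
  exact: measurable_sqnorm.
have abs_le : (\int[Q]_z `|(u z)%:E| <= (c * expR d%:R)%:E)%E.
  apply: (@le_trans _ _ (\int[Q]_z (c%:E * (expR (sqnorm z / 4))%:E))%E).
    apply: ge0_le_integral => //.
    - by do 2 apply: measurableT_comp => //.
    - by apply: emeasurable_funM.
    - by move=> z _; rewrite -EFinM lee_fin.
  rewrite ge0_integralZl//.
  by rewrite EFinM lee_wpmul2l// std_gauss_exp_sqnorm.
have ui : Q.-integrable setT (EFin \o u).
  apply/integrableP; split; first exact/measurable_EFinP.
  exact: le_lt_trans abs_le (ltry _).
split=> //; rewrite -lee_fin; apply: le_trans abs_le.
rewrite fineK; last exact: integrable_fin_num.
apply: le_integral => //; first exact: integrable_abse.
by move=> z _; rewrite lee_fin ler_norm.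
Qed.

Variable t : R.
Hypothesis t0 : 0 <= t.
Let A := [set z : d.-tuple (measurableTypeR R) | t <= sqnorm z].
Local Notation I z := ((t <= sqnorm z)%R%:R : R).

Lemma measurable_tail : measurable A.
Proof.
rewrite -[X in measurable X]setTI.
by apply: measurable_fun_le => //; exact: measurable_sqnorm.
Qed.

Lemma tail_indicE z : I z = \1_A z.
Proof.
rewrite indicE; case: (boolP (t <= sqnorm z)) => h; first by rewrite mem_set.
by rewrite memNset//; exact/negP.
Qed.

Lemma measurable_tail_indic : measurable_fun setT (fun z => I z).
Proof.
under eq_fun do rewrite tail_indicE.
by apply: measurable_indic; exact: measurable_tail.
Qed.

(** The first coordinate alone already has a tail of this size. *)
Lemma std_gauss_tail_ge : (0 < d)%N ->
  normal_tail_const * expR (- t) <= fine (Q A).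
Proof.
move=> d0; rewrite -lee_fin fineK; last exact: fin_num_measure measurable_tail.
apply: le_trans (normal_tail_ge t0) _.
have [_ coordE] := @iid_coord_law _ (measurableTypeR R) R
   (normal_prob 0 1) d (Ordinal d0).
have mB : measurable [set x : R | t <= x ^+ 2].
  rewrite -[X in measurable X]setTI.
  by apply: measurable_fun_le => //; exact: measurable_funX.
rewrite -(coordE _ mB); apply: le_measure; rewrite ?inE.
- by rewrite -[X in measurable X]setTI; exact: (@measurable_tnth _ (measurableTypeR R)).
- exact: measurable_tail.
move=> z /= /le_trans; apply; rewrite /sqnorm (bigD1 (Ordinal d0))//= lerDl.
by apply: sumr_ge0 => i _; exact: sqr_ge0.
Qed.

Lemma integral_tail_indic : \int[Q]_z I z = fine (Q A).
Proof.
rewrite /Rintegral; under eq_integral do rewrite tail_indicE.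
by rewrite integral_indic ?setIT//; exact: measurable_tail.
Qed.

(** From 1 + x <= exp x; it trades powers of the norm for exponential moments.
*)
Lemma sqnorm_le_expR z c : 0 < c -> sqnorm z <= c * expR (sqnorm z / c).
Proof.
move=> c0; rewrite mulrC -ler_pdivrMr//.
by apply: le_trans (expR_ge1Dx _); rewrite lerDr.
Qed.

Lemma integrable_tail : Q.-integrable setT (fun z => (I z)%:E).
Proof.
apply: (proj1 (std_gauss_dominated (u := fun z => I z) (c := 1) _ _)).
  exact: measurable_tail_indic.
move=> z; rewrite ger0_norm// mul1r; apply: (@le_trans _ _ 1).
  by rewrite lern1 leq_b1.
by rewrite -[leLHS]expR0 ler_expR mulr_ge0// sqnorm_ge0.
Qed.

Lemma integrable_sqnorm_tail :
  Q.-integrable setT (fun z => (sqnorm z * I z)%:E).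
Proof.
apply: (proj1 (std_gauss_dominated (u := fun z => sqnorm z * I z) (c := 4) _ _)).
  by apply: measurable_funM; [exact: measurable_sqnorm|exact: measurable_tail_indic].
move=> z; rewrite ger0_norm ?mulr_ge0 ?sqnorm_ge0//.
apply: le_trans (@sqnorm_le_expR z 4 _) => //.
by rewrite ler_piMr ?sqnorm_ge0// lern1 leq_b1.
Qed.

(** Where |z|^2 <= B the tail probability is enough; above B, Chernoff's
method applies to the difference, at half of the available exponential moment.
*)
Lemma sqnorm_tail_le B : 0 <= B ->
  \int[Q]_z (sqnorm z * I z) <= B * fine (Q A) + 8 * expR (d%:R - B / 8).
Proof.
move=> B0; rewrite -integral_tail_indic.
pose v z := (sqnorm z - B) * I z.
have mv : measurable_fun setT v.
  apply: measurable_funM; last exact: measurable_tail_indic.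
  by apply: measurable_funB => //; exact: measurable_sqnorm.
(* The indicator of |z|^2 >= t is kept inside v, so that only the excess over B
   remains to be dominated. *)
pose w z := Num.max (v z) 0.
have [] := @std_gauss_dominated w (8 * expR (- (B / 8))).
- exact: measurable_maxr.
- move=> z; rewrite ger0_norm ?le_max ?lexx ?orbT// ge_max; apply/andP; split.
    rewrite -mulrA -expRD /v.
    have := @sqnorm_le_expR z 8 ltac:(lra).
    have [SB|/ltW SB] := leP (sqnorm z) B => h.
      by rewrite (@le_trans _ _ 0) ?mulr_ge0 ?expR_ge0// mulr_le0_ge0 ?subr_le0.
    apply: (@le_trans _ _ (sqnorm z)).
      apply: (@le_trans _ _ (sqnorm z - B)); last by rewrite gerDl oppr_le0.
      by rewrite ler_piMr ?subr_ge0// lern1 leq_b1.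
    by apply: le_trans h _; rewrite ler_pM2l ?ler_expR//; lra.
  by rewrite !mulr_ge0 ?expR_ge0.
move=> wi wle.
rewrite -RintegralZl//; last exact: integrable_tail.
have iBI : Q.-integrable setT (EFin \o (fun z => B * I z)).
  exact: (integrableZl measurableT B integrable_tail).
rewrite addrC -lerBlDr -RintegralB//; last exact: integrable_sqnorm_tail.
rewrite addrC expRD mulrA (mulrC _ (expR d%:R)) mulrC.
apply: le_trans wle; apply: le_Rintegral => //.
  exact: (integrableB measurableT integrable_sqnorm_tail iBI).
by move=> z _; rewrite -mulrBl le_max lexx.
Qed.

End GaussianVector.

(** * Moments of sums of independent coordinates *)

Section SquareIntegrable.
Context {d : measure_display} {T : measurableType d} {R : realType}.
Variable P : probability T R.
Implicit Types f g h : T -> R.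

Lemma integrable_dominated f g : measurable_fun setT f ->
  P.-integrable setT (EFin \o g) -> (forall x, `|f x| <= g x) ->
  P.-integrable setT (EFin \o f).
Proof.
move=> mf gi fg; apply: le_integrable gi => //; first exact/measurable_EFinP.
by move=> x _; rewrite /= lee_fin (le_trans (fg x))// ler_norm.
Qed.

Lemma L2fun_integrable_mul f g : L2fun P f -> L2fun P g ->
  P.-integrable setT (EFin \o (fun x => f x * g x)).
Proof.
move=> [mf fi] [mg gi].
apply: (integrable_dominated (g := fun x => f x ^+ 2 + g x ^+ 2)).
- exact: measurable_funM.
- exact: (integrableD measurableT fi gi).
- move=> x; rewrite normrM -(real_normK (num_real (f x))) -(real_normK (num_real (g x))).
  have := sqr_ge0 (`|f x| - `|g x|); have := normr_ge0 (f x).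
  have := normr_ge0 (g x); nra.
Qed.

Lemma L2fun_cst c : L2fun P (fun=> c).
Proof. by split => //; exact: finite_measure_integrable_cst. Qed.

Lemma L2fun_integrable f : L2fun P f -> P.-integrable setT (EFin \o f).
Proof.
move=> fL2; have := L2fun_integrable_mul fL2 (L2fun_cst 1).
by under eq_fun do rewrite mulr1.
Qed.

Lemma L2funZ c f : L2fun P f -> L2fun P (fun x => c * f x).
Proof.
move=> [mf fi]; split; first exact: measurable_funM.
under eq_fun do rewrite exprMn.
exact: (integrableZl measurableT _ fi).
Qed.

Lemma L2funD f g : L2fun P f -> L2fun P g -> L2fun P (fun x => f x + g x).
Proof.
move=> fL2 gL2; have fgi := L2fun_integrable_mul fL2 gL2.
have [[mf fi] [mg gi]] := (fL2, gL2).
split; first exact: measurable_funD.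
have := integrableD measurableT fi (integrableD measurableT gi
  (integrableZl measurableT 2 fgi)).
by apply: eq_integrable => // x _; rewrite /= -EFinM -!EFinD sqrrD; congr EFin; ring.
Qed.

Lemma L2fun_sum (I : Type) (s : seq I) (A : pred I) (f : I -> T -> R) :
  (forall i, A i -> L2fun P (f i)) ->
  L2fun P (fun x => \sum_(i <- s | A i) f i x).
Proof.
move=> fL2; elim: s => [|i s IH].
  by under eq_fun do rewrite big_nil; exact: L2fun_cst.
under eq_fun do rewrite big_cons.
by case Ai: (A i) => //; apply: L2funD => //; exact: fL2.
Qed.

Lemma dotL2C f g : dotL2 P f g = dotL2 P g f.
Proof. by apply: eq_Rintegral => x _; rewrite mulrC. Qed.

Lemma dotL2Zl c f g : L2fun P f -> L2fun P g ->
  dotL2 P (fun x => c * f x) g = c * dotL2 P f g.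
Proof.
move=> fL2 gL2; rewrite -RintegralZl//; last exact: L2fun_integrable_mul.
by apply: eq_Rintegral => x _; rewrite mulrA.
Qed.

Lemma dotL2Dl f g h : L2fun P f -> L2fun P g -> L2fun P h ->
  dotL2 P (fun x => f x + g x) h = dotL2 P f h + dotL2 P g h.
Proof.
move=> fL2 gL2 hL2; rewrite /dotL2 -RintegralD//; try exact: L2fun_integrable_mul.
by apply: eq_Rintegral => x _; rewrite mulrDl.
Qed.

Lemma dotL2_suml (I : Type) (s : seq I) (A : pred I) (f : I -> T -> R) g :
  (forall i, A i -> L2fun P (f i)) -> L2fun P g ->
  dotL2 P (fun x => \sum_(i <- s | A i) f i x) g =
  \sum_(i <- s | A i) dotL2 P (f i) g.
Proof.
move=> fL2 gL2; elim: s => [|i s IH].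
  rewrite big_nil /dotL2; under eq_Rintegral do rewrite big_nil mul0r.
  by rewrite Rintegral_cst// mul0r.
rewrite big_cons -IH; under [X in dotL2 _ X]eq_fun do rewrite big_cons.
case Ai: (A i) => //; rewrite dotL2Dl//; first exact: fL2.
exact: L2fun_sum.
Qed.

Lemma dotL2_ge0 f : 0 <= dotL2 P f f.
Proof. by apply: Rintegral_ge0 => x _; rewrite -expr2 sqr_ge0. Qed.

Lemma normL2_sqr f : normL2 P f ^+ 2 = dotL2 P f f.
Proof. by rewrite sqr_sqrtr// dotL2_ge0. Qed.

Lemma markov_Rintegral f lam : 0 < lam -> (forall x, 0 <= f x) ->
  P.-integrable setT (EFin \o f) ->
  (P [set x | (lam <= f x)%R] <= (\int[P]_x f x / lam)%:E)%E.
Proof.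
move=> lam0 f0 fi; have mf := measurable_int _ fi.
have mA : measurable [set x | lam <= f x].
  rewrite -[X in measurable X]setTI.
  by apply: measurable_fun_le => //; exact/measurable_EFinP.
rewrite mulrC EFinM lee_pdivlMl// fineK; last exact: integrable_fin_num.
rewrite -(setIT [set x | _]) -integral_indic// -ge0_integralZl//; last first.
- by rewrite lee_fin ltW.
- exact/measurable_EFinP/measurable_indic.
apply: ge0_le_integral => //.
- by move=> x _; rewrite -EFinM lee_fin mulr_ge0// ltW.
- apply: emeasurable_funM => //.
  exact/measurable_EFinP/measurable_indic.
- move=> x _; rewrite -EFinM lee_fin indicE.
  case: (boolP (_ \in _)) => [|_]; last by rewrite mulr0.
  by rewrite inE/= mulr1.
Qed.

End SquareIntegrable.

Section IIDMoments.
Context {d : measure_display} {T : measurableType d} {R : realType}.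
Variables (P : probability T R) (n : nat).
Local Notation Pn := (iid_prob P n).

Lemma L2fun_coord (u : T -> R) (i : 'I_n) : L2fun P u ->
  L2fun Pn (fun z => u (tnth z i)).
Proof.
move=> [mu ui]; split.
  by apply: measurableT_comp => //; exact: measurable_tnth.
exact: (law_integrable (@iid_coord_law _ _ _ P n i) ui).
Qed.

(** For distinct coordinates the product integral factors, and it is enough
that the second factor is centered. *)
Lemma dotL2_coord (u v : T -> R) (i j : 'I_n) : L2fun P u -> L2fun P v ->
  \int[P]_x v x = 0 ->
  dotL2 Pn (fun z => u (tnth z i)) (fun z => v (tnth z j)) =
  (i == j)%:R * dotL2 P u v.
Proof.
move=> uL2 vL2 v0; case: (eqVneq i j) => [->|ij].
  rewrite mul1r; apply: (law_Rintegral (@iid_coord_law _ _ _ P n j)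
    (f := fun x => u x * v x)).
  exact: L2fun_integrable_mul.
have [ui vi] := (L2fun_integrable uL2, L2fun_integrable vL2).
apply: etrans (law_Rintegral (@iid_coord2_law _ _ _ P n i j ij)
  (f := fun x => u x.1 * v x.2) _) _; first exact: integrable_tensor.
by rewrite Rintegral_tensor// v0 mulr0 mul0r.
Qed.

(** Centered functions of distinct coordinates are orthogonal. *)
Lemma dotL2_additive (S : {set 'I_n}) (g : 'I_n -> T -> R) :
  (forall j, j \in S -> L2fun P (g j) /\ \int[P]_x g j x = 0) ->
  dotL2 Pn (fun z => \sum_(j in S) g j (tnth z j))
    (fun z => \sum_(j in S) g j (tnth z j)) =
  \sum_(j in S) dotL2 P (g j) (g j).
Proof.
move=> gS.
have cL2 j : j \in S -> L2fun Pn (fun z => g j (tnth z j)).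
  by move=> /gS[gL2 _]; exact: L2fun_coord.
rewrite dotL2_suml//; last exact: L2fun_sum.
apply: eq_bigr => j jS; rewrite dotL2C dotL2_suml//; last exact: cL2.
rewrite (bigD1 j)//= dotL2_coord ?eqxx ?mul1r; try by case: (gS j jS).
rewrite big1 ?addr0// => i /andP[iS ij].
rewrite dotL2_coord ?(negbTE ij) ?mul0r//; first by case: (gS i iS).
all: by case: (gS j jS).
Qed.

Lemma chebyshev_iid_sum (U : {set 'I_n}) (h : T -> R) (B lam : R) : 0 < lam ->
  L2fun P h -> \int[P]_x h x = 0 -> dotL2 P h h <= B ->
  (Pn [set z | (lam <= `|\sum_(j in U) h (tnth z j)|)%R] <=
   (n%:R * B / lam ^+ 2)%:E)%E.
Proof.
move=> lam0 hL2 h0 hB.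
have sL2 : L2fun Pn (fun z => \sum_(j in U) h (tnth z j)).
  by apply: L2fun_sum => j _; exact: L2fun_coord.
have := @markov_Rintegral _ _ _ Pn
  (fun z => (\sum_(j in U) h (tnth z j)) ^+ 2) (lam ^+ 2).
rewrite exprn_gt0// => /(_ isT (fun _ => sqr_ge0 _) (proj2 sL2)).
rewrite (_ : [set z | (lam ^+ 2 <= _)%R] =
    [set z | (lam <= `|\sum_(j in U) h (tnth z j)|)%R]); last first.
  apply/funext => z /=; rewrite -[X in lam ^+ 2 <= X]real_normK ?num_real//.
  by rewrite ler_pXn2r// nnegrE ltW.
move=> /le_trans; apply; rewrite lee_fin ler_wpM2r ?invr_ge0 ?sqr_ge0//.
under eq_Rintegral do rewrite expr2.
have := @dotL2_additive U (fun=> h) (fun j _ => conj hL2 h0).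
rewrite /dotL2/= => ->; rewrite sumr_const -/(dotL2 P h h).
have B0 : 0 <= B by apply: le_trans (dotL2_ge0 _ _) hB.
rewrite -[leLHS]mulr_natl ler_pM ?dotL2_ge0// ler_nat.
by rewrite -[X in (_ <= X)%N]card_ord max_card.
Qed.

Lemma Rintegral_iid_sum (U : {set 'I_n}) (h : T -> R) :
  P.-integrable setT (EFin \o h) ->
  Pn.-integrable setT (EFin \o (fun z => \sum_(j in U) h (tnth z j))) /\
  \int[Pn]_z (\sum_(j in U) h (tnth z j)) = #|U|%:R * \int[P]_x h x.
Proof.
move=> hi.
have ci j : Pn.-integrable setT (EFin \o (fun z => h (tnth z j))).
  exact: (law_integrable (@iid_coord_law _ _ _ P n j) hi).
have sE : EFin \o (fun z => \sum_(j in U) h (tnth z j)) =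
    fun z : n.-tuple T => (\sum_(j in U) (h (tnth z j))%:E)%E.
  by apply/funext => z; rewrite /= sumEFin.
split.
  by rewrite sE; apply: (integrable_sum measurableT) => j _; exact: ci.
have -> : \int[Pn]_z (\sum_(j in U) h (tnth z j)) =
    fine (\int[Pn]_z (\sum_(j in U) (h (tnth z j))%:E))%E.
  by congr fine; apply: eq_integral => z _; rewrite sumEFin.
rewrite (integral_sum measurableT)//.
have hE j : (\int[Pn]_z (h (tnth z j))%:E)%E = (\int[P]_x h x)%:E.
  rewrite (law_integral (@iid_coord_law _ _ _ P n j) hi) fineK//.
  exact: integrable_fin_num.
under eq_bigr do rewrite hE.
by rewrite sumEFin/= sumr_const -[LHS]mulr_natl.
Qed.

Lemma markov_iid_sum (U : {set 'I_n}) (h : T -> R) (B lam : R) : 0 < lam ->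
  (forall x, 0 <= h x) -> P.-integrable setT (EFin \o h) -> \int[P]_x h x <= B ->
  (Pn [set z | (lam <= \sum_(j in U) h (tnth z j))%R] <=
   (#|U|%:R * B / lam)%:E)%E.
Proof.
move=> lam0 h0 hi hB; have [si sE] := Rintegral_iid_sum U hi.
apply: le_trans (markov_Rintegral lam0 _ si) _.
  by move=> z; exact: sumr_ge0.
by rewrite lee_fin ler_wpM2r ?invr_ge0 ?(ltW lam0)// sE ler_wpM2l.
Qed.

End IIDMoments.

(** * The centered truncated chi-square variable *)

Section Excess.
Context {R : realType} (d : nat) (r : R).
Hypothesis d0 : (0 < d)%N.
Local Notation Q := (std_gauss d : probability (d.-tuple (measurableTypeR R)) R).
Let t : R := d%:R + r ^+ 2.
Let q : R := fine (Q [set z : d.-tuple (measurableTypeR R) | t <= sqnorm z]).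
Local Notation I z := ((t <= sqnorm z)%R%:R : R).
Local Notation al := (alpha r d).

(** The contribution of one coordinate to the statistic, as a function of its
energy. *)
Definition excess (x : R) : R := (x - al) * (t <= x)%R%:R.

Let t0 : 0 <= t. Proof. by rewrite addr_ge0// sqr_ge0. Qed.

Let q0 : 0 < q.
Proof.
apply: lt_le_trans _ (std_gauss_tail_ge t0 d0).
by rewrite mulr_gt0 ?expR_gt0 ?normal_tail_const_gt0.
Qed.

Let alphaM : al * q = \int[Q]_z (sqnorm z * I z).
Proof.
rewrite /alpha -/t -/q divfK ?gt_eqF// unlock; congr fine.
by apply: eq_integral => z _; rewrite tail_indicE.
Qed.

Lemma alpha_ge0 : 0 <= al.
Proof.
rewrite -(pmulr_lge0 _ q0) alphaM; apply: Rintegral_ge0 => z _.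
by rewrite mulr_ge0 ?sqnorm_ge0.
Qed.

(** The part of the conditional expectation of |z|^2 that comes from |z|^2 >
B, with B = 8 (d + t), is at most 8 exp(-t) before conditioning, while the
conditioning event has probability at least normal_tail_const exp(-t). *)
Lemma alpha_le : al <= 8 * (d%:R + t) + 8 / normal_tail_const.
Proof.
rewrite -(ler_pM2r q0) alphaM mulrDl.
have B0 : 0 <= 8 * (d%:R + t) by rewrite mulr_ge0// addr_ge0.
apply: le_trans (sqnorm_tail_le d t B0) _; rewrite lerD2l.
rewrite -[leRHS]mulrA ler_pM2l// ler_pdivlMl ?normal_tail_const_gt0//.
apply: le_trans _ (std_gauss_tail_ge t0 d0).
rewrite ler_pM2l ?normal_tail_const_gt0// ler_expR; lra.
Qed.

Lemma measurable_excess : measurable_fun setT excess.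
Proof.
apply: measurable_funM; first exact: measurable_funB.
rewrite (_ : (fun x => _) = \1_[set x : R | t <= x]); last first.
  apply/funext => x; rewrite indicE; case: (boolP (t <= x)) => h.
    by rewrite mem_set.
  by rewrite memNset//; exact/negP.
apply: measurable_indic; rewrite -[X in measurable X]setTI.
exact: measurable_fun_le.
Qed.

Let E (z : d.-tuple (measurableTypeR R)) : R := excess (sqnorm z).

Let mE : measurable_fun setT E.
Proof.
by apply: measurableT_comp; [exact: measurable_excess|exact: measurable_sqnorm].
Qed.

Lemma excess_L2 : L2fun Q E.
Proof.
split=> //.
apply: (proj1 (std_gauss_dominated (u := fun z => E z ^+ 2)
  (c := 128 + 2 * al ^+ 2) _ _)); first exact: measurable_funX.
move=> z; rewrite ger0_norm ?sqr_ge0// /E /excess.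
have := @sqnorm_le_expR _ _ z 8 ltac:(lra).
have S0 := sqnorm_ge0 z.
have e1 : 1 <= expR (sqnorm z / 4).
  by rewrite -[leLHS]expR0 ler_expR mulr_ge0.
move: e1; have -> : expR (sqnorm z / 4) = expR (sqnorm z / 8) ^+ 2.
  by rewrite expr2 -expRD; congr expR; lra.
set e := expR _ => e1 Se.
have SS : sqnorm z ^+ 2 <= 64 * e ^+ 2.
  have -> : 64 * e ^+ 2 = (8 * e) ^+ 2 by ring.
  by rewrite lerXn2r// nnegrE mulr_ge0// expR_ge0.
apply: (@le_trans _ _ ((sqnorm z - al) ^+ 2)).
  rewrite exprMn ler_piMr ?sqr_ge0// -natrX lern1.
  by case: (_ <= _)%R.
apply: (@le_trans _ _ (2 * sqnorm z ^+ 2 + 2 * al ^+ 2)).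
  have := sqr_ge0 (sqnorm z + al); nra.
have : al ^+ 2 <= al ^+ 2 * e ^+ 2 by rewrite ler_peMr// sqr_ge0.
by lra.
Qed.

(** This is what the definition of alpha achieves: alpha is the mean of |z|^2
given that the threshold is passed. *)
Lemma excess_mean : \int[Q]_z E z = 0.
Proof.
have iaI : Q.-integrable setT (EFin \o (fun z => al * I z)).
  exact: (integrableZl measurableT al (integrable_tail d t)).
have -> : \int[Q]_z E z = \int[Q]_z (sqnorm z * I z - al * I z).
  by apply: eq_Rintegral => z _; rewrite -mulrBl.
rewrite RintegralB//; last exact: (integrable_sqnorm_tail d t).
rewrite RintegralZl//; last exact: (integrable_tail d t).
by rewrite integral_tail_indic -alphaM subrr.
Qed.

(** Centering decreases the second moment, so that it suffices to bound the
integral of |z|^4 over the tail, and there |z|^4 <= 256 exp(|z|^2/8) <= 256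
exp(|z|^2/4 - t/8). *)
Lemma excess_sqr_le : dotL2 Q E E <= 16 ^+ 2 * expR (d%:R - t / 8).
Proof.
have ES := L2fun_integrable excess_L2.
have mS2 : measurable_fun setT
    (fun z : d.-tuple (measurableTypeR R) => sqnorm z ^+ 2 * I z).
  apply: measurable_funM; last exact: measurable_tail_indic.
  by apply: measurable_funX; exact: measurable_sqnorm.
have domS2 (z : d.-tuple (measurableTypeR R)) : `|sqnorm z ^+ 2 * I z| <=
    16 ^+ 2 * expR (- (t / 8)) * expR (sqnorm z / 4).
  have S0 := sqnorm_ge0 z.
  rewrite ger0_norm ?mulr_ge0 ?sqr_ge0//.
  have [tS|St] := boolP (t <= sqnorm z)%R; last first.
    by rewrite mulr0 !mulr_ge0 ?expR_ge0 ?exprn_ge0.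
  rewrite mulr1 -mulrA -expRD.
  have := @sqnorm_le_expR _ _ z 16 ltac:(lra).
  move=> /(lerXn2r 2) /=; rewrite !nnegrE => /(_ S0); rewrite mulr_ge0 ?expR_ge0//.
  move=> /(_ isT) /le_trans; apply.
  rewrite exprMn ler_pM2l ?exprn_gt0// expr2 -expRD ler_expR; lra.
have [Si Sle] := std_gauss_dominated mS2 domS2.
rewrite expRD mulrCA [leRHS]mulrC.
have iaE : Q.-integrable setT (EFin \o (fun z => al * E z)).
  exact: (integrableZl measurableT al ES).
have : \int[Q]_z (sqnorm z ^+ 2 * I z - al * E z) <=
    16 ^+ 2 * expR (- (t / 8)) * expR d%:R.
  by rewrite RintegralB// RintegralZl// excess_mean mulr0 subr0.
rewrite -mulrA (mulrC (expR _)); apply: le_trans; apply: le_Rintegral => //.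
- exact: L2fun_integrable_mul excess_L2 excess_L2.
- exact: (integrableB measurableT Si iaE).
move=> z _; rewrite /E /excess.
have [al0 S0] := (alpha_ge0, sqnorm_ge0 z).
have aS := mulr_ge0 al0 S0.
by case: (t <= sqnorm z)%R => /=; rewrite ?mulr1 ?mulr0 ?subr0//; nra.
Qed.

End Excess.

(** * The test in the Gaussian sequence model *)

Section GaussianTest.
Context {R : realType} (p d : nat) (r : R).
Hypothesis d0 : (0 < d)%N.
Local Notation block := (d.-tuple (measurableTypeR R)).
Local Notation Q := (std_gauss d : probability block R).
Local Notation Gam := (iid_prob Q p).
Local Notation t := (d%:R + r ^+ 2).
Local Notation h := (excess d r).
Implicit Types (z : p.-tuple block) (a : 'I_p -> 'I_d -> R) (S : {set 'I_p}).

Definition shifted_sqnorm (b : 'I_d -> R) (x : block) : R :=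
  \sum_(k < d) (b k + tnth x k) ^+ 2.

Definition gauss_statistic a z : R :=
  \sum_(j < p) h (shifted_sqnorm (a j) (tnth z j)).

Lemma measurable_gauss_statistic a : measurable_fun setT (gauss_statistic a).
Proof.
apply: measurable_sum => j.
apply: (measurableT_comp (measurable_excess d r)).
apply: (measurableT_comp (f := shifted_sqnorm (a j)));
  last exact: measurable_tnth.
apply: measurable_sum => k; apply: measurable_funX; apply: measurable_funD => //.
exact: (@measurable_tnth _ (measurableTypeR R)).
Qed.

(** (b + x)^2 >= b^2/2 - x^2, since the difference is (b + 2x)^2/2. *)
Lemma shifted_sqnorm_ge (b : 'I_d -> R) (x : block) :
  (\sum_(k < d) b k ^+ 2) / 2 - sqnorm x <= shifted_sqnorm b x.
Proof.
rewrite /sqnorm mulr_suml -sumrB; apply: ler_sum => k _.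
have := sqr_ge0 (b k + 2 * tnth x k); nra.
Qed.

Lemma shifted_sqnorm0 (b : 'I_d -> R) (x : block) :
  (forall k, b k = 0) -> shifted_sqnorm b x = sqnorm x.
Proof. by move=> b0; apply: eq_bigr => k _; rewrite b0 add0r. Qed.

(** Below the threshold the left-hand side is nonpositive because A >= t. *)
Lemma excess_ge A x : alpha r d <= A -> t <= A -> x - A <= h x.
Proof.
move=> aA tA; rewrite /excess; case: (leP t x) => tx; rewrite ?mulr1 ?mulr0; lra.
Qed.

Lemma noise_excess_tail S lam : 0 < lam ->
  (Gam [set z | (lam <= `|\sum_(j in S) h (sqnorm (tnth z j))|)%R] <=
   (p%:R * (16 ^+ 2 * expR (d%:R - t / 8)) / lam ^+ 2)%:E)%E.
Proof.
move=> lam0.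
apply: (chebyshev_iid_sum S lam0 (h := fun x : block => h (sqnorm x))).
- exact: excess_L2.
- exact: excess_mean.
- exact: excess_sqr_le.
Qed.

(** The exact value of the integral is d; the bound on one coordinate comes
from x^2 <= 4 exp(x^2/4). *)
Lemma std_gauss_sqnorm_le :
  Q.-integrable setT (EFin \o (fun x : block => sqnorm x)) /\
  \int[Q]_x sqnorm x <= 8 * d%:R.
Proof.
have mX : measurable_fun setT (fun x : measurableTypeR R => x ^+ 2 : R).
  exact: measurable_funX.
have i1 : (\int[normal_prob (0 : R) 1]_x (x ^+ 2)%:E <= 8%:E)%E.
  apply: (@le_trans _ _
    (\int[normal_prob (0 : R) 1]_x (4%:E * (expR (x ^+ 2 / 4))%:E))%E).
    apply: ge0_le_integral => //.
    - by move=> x _; rewrite lee_fin sqr_ge0.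
    - exact/measurable_EFinP.
    - apply: emeasurable_funM => //; apply/measurable_EFinP.
      by apply: measurableT_comp => //; exact: measurable_funM.
    - move=> x _; rewrite -EFinM lee_fin mulrC -ler_pdivrMr//.
      by apply: le_trans (expR_ge1Dx _); rewrite lerDr.
  rewrite ge0_integralZl//; last first.
    apply/measurable_EFinP; apply: measurableT_comp => //.
    exact: measurable_funM.
  apply: le_trans (_ : (4%:E * 2%:E <= _)%E); last by rewrite -EFinM lee_fin; lra.
  by rewrite lee_wpmul2l// normal_exp_sqr_le2.
have Ni : (normal_prob (0 : R) 1).-integrable setT
    (EFin \o (fun x : measurableTypeR R => x ^+ 2 : R)).
  apply/integrableP; split; first exact/measurable_EFinP.
  apply: le_lt_trans (ltry 8); apply: le_trans i1.
  apply: ge0_le_integral => //.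
  - apply: measurableT_comp => //; exact/measurable_EFinP.
  - exact/measurable_EFinP.
  - by move=> x _; rewrite /= ger0_norm ?sqr_ge0.
have [si sE] := @Rintegral_iid_sum _ (measurableTypeR R) R
  (normal_prob 0 1) d [set: 'I_d]%SET (fun x => x ^+ 2) Ni.
have sqE : (fun z : block => \sum_(j in [set: 'I_d]%SET) tnth z j ^+ 2) = @sqnorm R d.
  by apply/funext => z; apply: eq_bigl => j; rewrite inE.
move: si sE; rewrite sqE => si ->; split=> //.
rewrite cardsT card_ord mulrC ler_wpM2r// -lee_fin fineK//.
exact: integrable_fin_num.
Qed.

Lemma noise_energy_tail S lam : 0 < lam ->
  (Gam [set z | (lam <= \sum_(j in S) sqnorm (tnth z j))%R] <=
   (#|S|%:R * (8 * d%:R) / lam)%:E)%E.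
Proof.
move=> lam0; have [si sle] := std_gauss_sqnorm_le.
by apply: (markov_iid_sum S lam0 (h := fun x : block => sqnorm x)) => // x;
   exact: sqnorm_ge0.
Qed.

Let measurable_noise_excess S : measurable_fun setT
  (fun z => \sum_(j in S) h (sqnorm (tnth z j))).
Proof.
under eq_fun do rewrite big_mkcond.
apply: measurable_sum => j; case: (j \in S) => //.
apply: (measurableT_comp (f := fun x : block => h (sqnorm x)));
  last exact: measurable_tnth.
by case: (excess_L2 d r).
Qed.

Lemma gauss_statistic_typeI a (c : R) : 0 < c -> (forall j k, a j k = 0) ->
  (Gam [set z | (c < gauss_statistic a z)%R] <=
   (p%:R * (16 ^+ 2 * expR (d%:R - t / 8)) / c ^+ 2)%:E)%E.
Proof.
move=> c0 a0; apply: le_trans (noise_excess_tail [set: 'I_p]%SET c0).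
apply: le_measure; rewrite ?inE.
- have -> : [set z | c < gauss_statistic a z] =
      setT `&` gauss_statistic a @^-1` `]c, +oo[%classic.
    by rewrite setTI; apply/funext => z /=; rewrite in_itv/= andbT.
  exact: (measurable_gauss_statistic a measurableT).
- rewrite -[X in measurable X]setTI; apply: measurable_fun_le => //.
  exact: measurableT_comp.
move=> z /= cz; apply: le_trans (ltW cz) (le_trans (ler_norm _) _).
rewrite le_eqVlt; apply/orP; left; apply/eqP; congr `|_|.
by apply: eq_big => [j|j _]; rewrite ?inE// shifted_sqnorm0.
Qed.

(** If the statistic stays below c, then either the coordinates without signal
contribute at most -c, or the noise energy on S exceeds m: otherwise the
signal, which pays for m, for the centering A of each coordinate of S and for
2c, pushes the statistic above c. *)
Lemma gauss_statistic_typeII a S (A c m : R) :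
  alpha r d <= A -> t <= A -> 0 < c -> 0 < m ->
  (forall j, j \notin S -> forall k, a j k = 0) ->
  m + #|S|%:R * A + 2 * c <=
    (\sum_(j in S) \sum_(k < d) a j k ^+ 2) / 2 ->
  (Gam [set z | (gauss_statistic a z <= c)%R] <=
   (p%:R * (16 ^+ 2 * expR (d%:R - t / 8)) / c ^+ 2 +
    #|S|%:R * (8 * d%:R) / m)%:E)%E.
Proof.
move=> aA tA c0 m0 aS sig.
pose B1 : set (p.-tuple block) :=
  [set z | c <= `|\sum_(j in ~: S) h (sqnorm (tnth z j))|].
pose B2 : set (p.-tuple block) :=
  [set z | m <= \sum_(j in S) sqnorm (tnth z j)].
have ms : measurable_fun setT
    (fun z : p.-tuple block => \sum_(j in S) sqnorm (tnth z j)).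
  under eq_fun do rewrite big_mkcond.
  apply: measurable_sum => j; case: (j \in S) => //.
  apply: (measurableT_comp (f := fun x : block => sqnorm x));
    first exact: measurable_sqnorm.
  exact: measurable_tnth.
have mB1 : measurable B1.
  rewrite -[X in measurable X]setTI; apply: measurable_fun_le => //.
  exact: measurableT_comp (measurable_noise_excess _).
have mB2 : measurable B2.
  by rewrite -[X in measurable X]setTI; exact: measurable_fun_le.
apply: (@le_trans _ _ (Gam (B1 `|` B2))).
  apply: le_measure; rewrite ?inE; last move=> z /= sc.
  - rewrite -[X in measurable X]setTI; apply: measurable_fun_le => //.
    exact: measurable_gauss_statistic.
  - exact: measurableU.
  have [|B1z] := leP c `|\sum_(j in ~: S) h (sqnorm (tnth z j))|; first by left.
  right; rewrite /B2/=; rewrite leNgt; apply/negP => B2z.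
  move: B1z; rewrite ltr_norml => /andP[B1z _].
  move: sc; apply/negP; rewrite -ltNge.
  rewrite /gauss_statistic (bigID (mem S))/=.
  rewrite [X in _ < _ + X](_ : _ = \sum_(j in ~: S) h (sqnorm (tnth z j)));
    last first.
    apply: eq_big => j; first by rewrite !inE.
    by move=> jS; rewrite shifted_sqnorm0//; exact: aS.
  have low : \sum_(j in S) ((\sum_(k < d) a j k ^+ 2) / 2 - sqnorm (tnth z j) - A)
      <= \sum_(j in S) h (shifted_sqnorm (a j) (tnth z j)).
    apply: ler_sum => j _; apply: le_trans (excess_ge _ aA tA).
    by rewrite lerD2r shifted_sqnorm_ge.
  rewrite !sumrB -mulr_suml sumr_const -[A *+ _]mulr_natl in low.
  lra.
apply: le_trans (measureU2 Gam mB1 mB2) _.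
rewrite EFinD; apply: leeD; first exact: noise_excess_tail.
exact: noise_energy_tail.
Qed.

End GaussianTest.

(** * Expansion of the functions of H_0 *)

Section Mercer.
Context {R : realType}.
Local Notation U := (unit_interval R).
Variables (H : set (R -> R)) (ip : (R -> R) -> (R -> R) -> R)
  (mu : nat -> R) (psi : nat -> R -> R).
Hypothesis HM : rkhs_model H ip mu psi.
Implicit Types g : R -> R.

Let theta g k := dotL2 U g (psi k).

Let psi_L2 k : L2fun U (psi k).
Proof. by have [K [_ [[]]]] := model_H0 HM. Qed.

Let psi_on i j : dotL2 U (psi i) (psi j) = (i == j)%:R.
Proof. by have [K [_ [[]]]] := model_H0 HM. Qed.

Let centered_L2 g : centered H g -> L2fun U g.
Proof. by move=> [Hg _]; exact: model_L2 HM _ Hg. Qed.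

(** The norm formula applied to g, to K_x and to their sum gives the inner
product of g and K_x as the sum of <g, psi_k> <K_x, psi_k> / mu_k. Here <K_x,
psi_k> = mu_k psi_k(x), and the inner product is g(x). *)
Lemma mercer_pointwise g x : centered H g -> x \in `[0, 1] ->
  series (fun k => theta g k * psi k x) @ \oo --> g x.
Proof.
move=> Hg x01; have [K [rk me]] := model_H0 HM.
have HK : centered H (K x) := rkhs_kernel rk x01.
pose w := fun y => 1 * g y + 1 * K x y.
have Hw : centered H w := rkhs_comb rk 1 1 Hg HK.
have ipw : ip w w = ip g g + 2 * g x + ip (K x) (K x).
  rewrite (rkhs_linear rk _ _ Hg HK Hw) !mul1r.
  rewrite (rkhs_sym rk Hg Hw) (rkhs_sym rk HK Hw).
  rewrite !(rkhs_linear rk _ _ Hg HK)// !mul1r.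
  rewrite (rkhs_sym rk HK Hg) (rkhs_reproducing rk Hg x01); ring.
have : _ --> _ := cvgM (cvgB (cvgB (model_norm HM Hw) (model_norm HM Hg))
  (model_norm HM HK)) (cvg_cst (2^-1 : R)).
rewrite ipw (_ : _ * 2^-1 = g x); last by field.
set F := (X in X @ _ --> _) => c.
have -> : series (fun k => theta g k * psi k x) = F; last exact: c.
apply/funext => n; rewrite /F !fctE /series/= -!sumrB mulr_suml; apply: eq_bigr => k _.
have Kk : dotL2 U (K x) (psi k) = mu k * psi k x := mercer_eigen me k x01.
rewrite (_ : dotL2 U w (psi k) = theta g k + mu k * psi k x); last first.
  rewrite -Kk /w; under eq_fun do rewrite !mul1r.
  by rewrite dotL2Dl//; exact: centered_L2.
rewrite Kk -/(theta g k).
have [mu0|mu0] := eqVneq (mu k) 0; last by field.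
(* A null eigenvalue contributes 0 to the expansion, as the coefficient vanishes. *)
by rewrite /theta (model_null HM Hg mu0) mu0 invr0; ring.
Qed.

Lemma unit_interval_ge0_integral (f : R -> \bar R) : measurable_fun setT f ->
  (forall x, 0 <= f x)%E -> (\int[U]_x f x = \int[U]_(x in `[0%R, 1%R]) f x)%E.
Proof.
move=> mf f0.
rewrite (@ge0_negligible_integral _ _ _ U setT (~` `[0%R, 1%R]))//.
- by rewrite setTD setCK.
- by apply: measurableC.
- rewrite /unit_interval /= /uniform_prob integral_uniform_pdf.
  by rewrite setICl integral_set0.
Qed.

Lemma eigenvalue_noninc i j : (i <= j)%N -> mu j <= mu i.
Proof.
have [K [_ me]] := model_H0 HM.
by have /nonincreasing_seqP := mercer_noninc me; exact.
Qed.

Let mu_ge0 k : 0 <= mu k.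
Proof. by have [K [_ []]] := model_H0 HM. Qed.

(** For k >= d, theta_k^2 <= mu_d (theta_k^2 / mu_k), and the squared norm of
g is the sum of the theta_k^2 / mu_k. *)
Lemma coefs_tail_le g d N : centered H g -> ip g g <= 1 ->
  \sum_(0 <= k < N) theta g k ^+ 2 <= \sum_(0 <= k < d) theta g k ^+ 2 + mu d.
Proof.
move=> Hg g1.
have th0 k : 0 <= (mu k)^-1 * theta g k ^+ 2.
  by rewrite mulr_ge0 ?invr_ge0 ?sqr_ge0.
apply: (@le_trans _ _ (\sum_(0 <= k < N) ((k < d)%N%:R * theta g k ^+ 2 +
    mu d * ((mu k)^-1 * theta g k ^+ 2)))).
  apply: ler_sum => k _; case: (ltnP k d) => kd.
    by rewrite mul1r lerDl mulr_ge0.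
  rewrite mul0r add0r; have [muk|muk] := eqVneq (mu k) 0.
    by rewrite /theta (model_null HM Hg muk) expr0n/= !mulr0.
  rewrite mulrA ler_peMl ?sqr_ge0//.
  rewrite ler_pdivlMr ?mul1r ?eigenvalue_noninc//.
  by rewrite lt_neqAle eq_sym muk mu_ge0.
rewrite big_split/= -mulr_sumr; apply: lerD.
  have [dN|/ltnW Nd] := leqP d N.
    rewrite (big_cat_nat (leq0n d) dN)/= [X in _ + X]big_nat [X in _ + X]big1 ?addr0.
      rewrite [leLHS]big_nat [leRHS]big_nat; apply: ler_sum => k /andP[_ kd].
      by rewrite kd mul1r.
    by move=> k /andP[dk _]; rewrite ltnNge dk mul0r.
  rewrite (big_cat_nat (leq0n N) Nd)/= -[leLHS]addr0; apply: lerD.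
    by apply: ler_sum => k _; rewrite ler_piMl ?sqr_ge0// lern1 leq_b1.
  by apply: sumr_ge0 => k _; exact: sqr_ge0.
rewrite ler_piMr//; apply: le_trans g1.
have cv := model_norm HM Hg; rewrite -(cvg_lim (@Rhausdorff R) cv).
apply: (nondecreasing_cvgn_le
  (u_ := series (fun k => (mu k)^-1 * theta g k ^+ 2))); last first.
  by apply/cvg_ex; exists (ip g g).
apply/nondecreasing_seqP => n.
by rewrite /series/= big_nat_recr//= lerDl.
Qed.

Let partial g N x := \sum_(0 <= k < N) theta g k * psi k x.

Let partial_L2 g N : L2fun U (partial g N).
Proof. by apply: L2fun_sum => k _; exact: L2funZ. Qed.

Let partial_norm g N :
  dotL2 U (partial g N) (partial g N) = \sum_(0 <= k < N) theta g k ^+ 2.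
Proof.
rewrite dotL2_suml// => [|k _]; last exact: L2funZ.
rewrite big_nat [RHS]big_nat; apply: eq_bigr => k /andP[_ kN].
rewrite dotL2Zl// dotL2C dotL2_suml//; last by move=> i _; exact: L2funZ.
rewrite (bigD1_seq k) ?mem_index_iota ?iota_uniq//=.
rewrite big1 ?addr0 => [|i ik].
  by rewrite dotL2Zl// psi_on eqxx mulr1.
by rewrite dotL2Zl// psi_on (negbTE ik) mulr0.
Qed.

(** The partial sums of the expansion converge to g pointwise, and their
squared norms are the partial sums of the theta_k^2; Fatou's lemma gives the
inequality without convergence in L^2. *)
Lemma norm_le_coefs g d : centered H g -> ip g g <= 1 ->
  dotL2 U g g <= \sum_(0 <= k < d) theta g k ^+ 2 + mu d.
Proof.
move=> Hg g1; set B := _ + _.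
have gL2 := centered_L2 Hg.
pose I01 : set R := `[0, 1]%classic.
pose S N x := (partial g N x ^+ 2)%:E.
have mS N : measurable_fun setT (S N).
  apply/measurable_EFinP; apply: measurable_funX.
  by have [] := partial_L2 g N.
have intS N : (\int[U]_(x in I01) S N x =
    (\sum_(0 <= k < N) theta g k ^+ 2)%:E)%E.
  rewrite -unit_interval_ge0_integral//; last first.
    by move=> x; rewrite lee_fin sqr_ge0.
  rewrite -partial_norm /dotL2 fineK.
    by apply: eq_integral => x _; rewrite /S expr2.
  apply: integrable_fin_num => //.
  exact: L2fun_integrable_mul (partial_L2 g N) (partial_L2 g N).
have cvs : cvgn (fun N => \sum_(0 <= k < N) theta g k ^+ 2).
  apply: nondecreasing_is_cvgn.
    apply/nondecreasing_seqP => n.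
    by rewrite big_nat_recr//= lerDl sqr_ge0.
  by exists B => _ [N _ <-]; exact: coefs_tail_le.
have limS x : I01 x -> limn_einf (S ^~ x) = (g x ^+ 2)%:E.
  move=> x01; have /cvg_limn_einf_sup[-> _] // : S ^~ x @ \oo --> (g x ^+ 2)%:E.
  apply: cvg_EFin; first exact: nearW.
  have c := mercer_pointwise Hg x01; rewrite expr2.
  have -> : fine \o S ^~ x = series (fun k => theta g k * psi k x) \*
      series (fun k => theta g k * psi k x).
    by apply/funext => N; rewrite /= expr2.
  exact: (cvgM c c).
have fat := @fatou _ _ _ U I01 (measurable_itv _) S
  (fun N => measurable_funTS (mS N))
  (fun N x _ => (sqr_ge0 (partial g N x) : (0 <= S N x)%E)).
rewrite -lee_fin /dotL2 fineK; last first.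
  by apply: integrable_fin_num => //; exact: L2fun_integrable_mul.
rewrite (unit_interval_ge0_integral (f := fun x => (g x * g x)%:E)); last 2 first.
- by case: gL2 => mg _; apply/measurable_EFinP; exact: measurable_funM.
- by move=> x; rewrite lee_fin -expr2 sqr_ge0.
rewrite (_ : (\int[U]_(x in _) _)%E =
    (\int[U]_(x in I01) limn_einf (S ^~ x))%E); last first.
  by apply: eq_integral => x; rewrite inE => x01; rewrite limS// expr2.
apply: le_trans fat _; under eq_fun do rewrite intS.
have /cvg_ex[l sl] := cvs.
have /cvg_limn_einf_sup[-> _] :
    (fun N => (\sum_(0 <= k < N) theta g k ^+ 2)%:E) @ \oo --> l%:E.
  by apply: cvg_EFin => //; exact: nearW.
rewrite lee_fin -(cvg_lim (@Rhausdorff R) sl); apply: limr_le => //.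
by apply: nearW => N; exact: coefs_tail_le.
Qed.

End Mercer.

(** * From white noise to the sequence model *)

Section SequenceModel.
Context {R : realType}.
Local Notation U := (unit_interval R).
Local Notation block d := (d.-tuple (measurableTypeR R)).
Variables (H : set (R -> R)) (ip : (R -> R) -> (R -> R) -> R)
  (mu : nat -> R) (psi : nat -> R -> R).
Hypothesis HM : rkhs_model H ip mu psi.
Variable p : nat.

Definition coord_fun (k : nat) (j : 'I_p) (x : p.-tuple R) : R :=
  psi k (tnth x j).

Let psi_L2 k : L2fun U (psi k).
Proof. by have [K [_ [[]]]] := model_H0 HM. Qed.

Let psi_mean0 k : \int[U]_x psi k x = 0.
Proof.
rewrite -(model_orth1 HM k) /dotL2.
by apply: eq_Rintegral => x _; rewrite mulr1.
Qed.

Lemma centered_L2_mean0 g : centered H g -> L2fun U g /\ \int[U]_x g x = 0.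
Proof.
move=> [Hg g0]; split; first exact: model_L2 HM _ Hg.
by rewrite -[RHS]g0; apply: eq_Rintegral => x _; rewrite mulr1.
Qed.

Lemma coord_fun_L2 k j : L2fun (unit_cube R p) (coord_fun k j).
Proof. exact: (@L2fun_coord _ (measurableTypeR R) R U p (psi k) j (psi_L2 k)). Qed.

(** Across coordinates, orthogonality holds because the psi_k are orthogonal
to constants. *)
Lemma coord_fun_orthonormal d :
  Defs.orthonormal (unit_cube R p)
    (fun q : 'I_p * 'I_d => coord_fun q.2 q.1).
Proof.
have on i j : dotL2 U (psi i) (psi j) = (i == j)%:R.
  by have [K [_ [[]]]] := model_H0 HM.
split=> [[j k]|[i k] [j l]]; first exact: coord_fun_L2.
apply: etrans (@dotL2_coord _ (measurableTypeR R) R U p _ _ i j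
  (psi_L2 k) (psi_L2 l) (psi_mean0 l)) _.
by rewrite on xpair_eqE -natrM mulnb.
Qed.

Lemma additive_coef (S : {set 'I_p}) (g : 'I_p -> R -> R) k j :
  (forall i, i \in S -> centered H (g i)) ->
  dotL2 (unit_cube R p) (fun x => \sum_(i in S) g i (tnth x i)) (coord_fun k j) =
  (j \in S)%:R * dotL2 U (g j) (psi k).
Proof.
move=> gS.
rewrite (@dotL2_suml _ (p.-tuple (measurableTypeR R)) R (unit_cube R p) _ _ _
    (fun i (x : p.-tuple R) => g i (tnth x i))); last 2 first.
- move=> i iS; apply: (@L2fun_coord _ (measurableTypeR R) R U p (g i) i).
  by case: (centered_L2_mean0 (gS i iS)).
- exact: coord_fun_L2.
have E i : i \in S -> dotL2 (unit_cube R p) (fun x => g i (tnth x i))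
    (coord_fun k j) = (i == j)%:R * dotL2 U (g i) (psi k).
  move=> iS; apply: (@dotL2_coord _ (measurableTypeR R) R U p _ _ i j) => //.
  by case: (centered_L2_mean0 (gS i iS)).
rewrite (eq_bigr _ E); case: (boolP (j \in S)) => jS.
  rewrite (bigD1 j)//= eqxx big1 ?addr0// => i /andP[_ /negbTE->].
  by rewrite mul0r.
rewrite mul0r big1// => i iS; case: eqP => [ij|_]; last by rewrite mul0r.
by rewrite ij (negbTE jS) in iS.
Qed.

Lemma additive_norm (S : {set 'I_p}) (g : 'I_p -> R -> R) :
  (forall i, i \in S -> centered H (g i)) ->
  dotL2 (unit_cube R p) (fun x => \sum_(i in S) g i (tnth x i))
    (fun x => \sum_(i in S) g i (tnth x i)) =
  \sum_(i in S) dotL2 U (g i) (g i).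
Proof.
move=> gS; apply: (@dotL2_additive _ (measurableTypeR R) R U p S g) => i iS.
exact: centered_L2_mean0 (gS i iS).
Qed.

Context {disp : measure_display} {Omega : measurableType disp}.
Variables (P : probability Omega R) (W : (p.-tuple R -> R) -> {RV P >-> R}).
Hypothesis WN : is_white_noise W.

Definition shift n d (f : p.-tuple R -> R) (j : 'I_p) (k : 'I_d) : R :=
  Num.sqrt n%:R * dotL2 (unit_cube R p) f (coord_fun k j).

(** The shift enters the observation through its coefficients only, and after
multiplication by sqrt n the noise has unit variance. *)
Lemma statistic_law n d r (f : p.-tuple R -> R) (B : set R) : (0 < n)%N ->
  measurable B ->
  P [set w | B (statistic psi n r d (observation W n f w))] =
  iid_prob (std_gauss d) p
    [set z | B (gauss_statistic r (shift n f) z)].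
Proof.
move=> n0 mB.
have [mZ ZE] := white_noise_law WN (coord_fun_orthonormal d).
rewrite -ZE; last first.
  rewrite -[X in measurable X]setTI.
  have mS := @measurable_gauss_statistic R p d r (shift n f).
  exact: mS measurableT B mB.
congr (P _); apply/funext => w /=; congr (B _).
apply: eq_bigr => j _; rewrite /excess.
suff -> : energy psi n (observation W n f w) d j = shifted_sqnorm
    (shift n f j) (tnth [tuple [tuple W (coord_fun k j) w | k < d] | j < p] j) by [].
(* The normalization n of the energy is absorbed as (sqrt n)^2. *)
have sn0 : Num.sqrt n%:R != 0 :> R by rewrite gt_eqF// sqrtr_gt0 ltr0n.
rewrite /energy mulr_sumr; apply: eq_bigr => k _.
rewrite !tnth_mktuple -[n%:R](@sqr_sqrtr R) ?ler0n// -exprMn.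
by rewrite /coeff /observation mulrDr mulrA mulfV// mul1r.
Qed.

End SequenceModel.

(** * Size of the noise, the truncation error and the signal *)

Section LogFactor.
Context {R : realType}.

Section Sparse.
Variables p s : nat.
Hypotheses (s1 : (1 <= s)%N) (sp : (s%:R : R) < Num.sqrt p%:R).

Let s0 : 0 < s%:R :> R. Proof. by rewrite ltr0n. Qed.

Let s2p : s%:R ^+ 2 < p%:R :> R.
Proof.
rewrite -[ltRHS](@sqr_sqrtr R) ?ler0n//.
by rewrite ltrXn2r// nnegrE ?sqrtr_ge0// ltW.
Qed.

Let ratio_ge1 : 1 <= p%:R / s%:R ^+ 2 :> R.
Proof. by rewrite ler_pdivlMr ?exprn_gt0// mul1r ltW. Qed.

(** The ratio p/s^2 is at least 1 in the sparse regime. *)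
Lemma log_factor_ge : ln 2 <= log_factor p s :> R.
Proof.
rewrite /log_factor ler_ln ?posrE//; have := ratio_ge1; lra.
Qed.

(** exp(-L) = s^2 / (s^2 + p). *)
Lemma expR_log_factor_le : p%:R * expR (- log_factor p s) <= s%:R ^+ 2 :> R.
Proof.
rewrite expRN /log_factor lnK ?posrE; last by have := ratio_ge1; lra.
rewrite ler_pdivrMr; last by have := ratio_ge1; lra.
by rewrite mulrDr mulr1 mulrCA mulfV ?gt_eqF ?exprn_gt0// mulr1 lerDr ltW// exprn_gt0.
Qed.

End Sparse.
End LogFactor.

Section Detection.
Context {R : realType}.
Variables (H : set (R -> R)) (ip : (R -> R) -> (R -> R) -> R)
  (mu : nat -> R) (psi : nat -> R -> R).
Hypothesis HM : rkhs_model H ip mu psi.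
Variables (K3 : R) (p n s nu d : nat).
Hypotheses (K3_gt0 : 0 < K3) (n0 : (0 < n)%N).
Hypotheses (nu_level : is_truncation_level mu p s n nu) (nud : (nu <= d)%N).
Local Notation L := (log_factor p s : R).
Hypotheses (L_ge : K3 ^+ 2 * d%:R <= L).

Let nR : 0 < n%:R :> R. Proof. by rewrite ltr0n. Qed.

(** With eigenvalues indexed from 0, mu_d comes after the eigenvalue mu_(nu-1)
controlled by the truncation level, and nu <= d <= L / K3^2. *)
Lemma truncated_eigenvalue_le : n%:R * mu d <= L / K3.
Proof.
have [[nu0 munu] _] := nu_level.
have L0 : 0 <= L by apply: le_trans L_ge; rewrite mulr_ge0 ?sqr_ge0.
have : mu d <= Num.sqrt (nu%:R * L) / n%:R.
  apply: le_trans munu; apply: (eigenvalue_noninc HM).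
  by rewrite (leq_trans (leq_pred _)).
rewrite ler_pdivlMr// mulrC => /le_trans; apply.
rewrite -(@ler_pXn2r _ 2) ?nnegrE ?sqrtr_ge0 ?divr_ge0 ?(ltW K3_gt0)//.
rewrite sqr_sqrtr ?mulr_ge0// exprMn exprVn ler_pdivlMr ?exprn_gt0//.
rewrite mulrAC [leRHS]expr2 ler_wpM2r// mulrC.
by apply: le_trans L_ge; rewrite ler_pM2l ?exprn_gt0// ler_nat.
Qed.

(** Each of the at most s components of the signal loses at most one
eigenvalue by truncation. *)
Lemma signal_energy_ge (S : {set 'I_p}) f (rho : R) :
  (#|S| <= s)%N -> additive_class H ip S f ->
  0 <= rho -> rho <= normL2 (unit_cube R p) f ->
  n%:R * rho ^+ 2 - s%:R * (L / K3) <=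
    \sum_(j in S) \sum_(k < d) shift psi n f j k ^+ 2 /\
  (forall j, j \notin S -> forall k : 'I_d, shift psi n f j k = 0).
Proof.
move=> Ss [g [gS ->]] rho0 rhof.
have gC i : i \in S -> centered H (g i) by move=> /gS[].
split; last first.
  by move=> j jS k; rewrite /shift (additive_coef HM k j gC) (negbTE jS) mul0r mulr0.
have g1 i : i \in S -> ip (g i) (g i) <= 1.
  move=> /gS[gCi]; have [K [rk _]] := model_H0 HM.
  rewrite -{1}sqrtr1 ler_sqrt//.
have nrm : rho ^+ 2 <= \sum_(i in S) dotL2 (unit_interval R) (g i) (g i).
  rewrite -(additive_norm HM gC) -normL2_sqr.
  by rewrite lerXn2r// nnegrE sqrtr_ge0.
have en j : j \in S ->
    n%:R * dotL2 (unit_interval R) (g j) (g j) - n%:R * mu d <=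
    \sum_(k < d) shift psi n
      (fun x : p.-tuple R => \sum_(i in S) g i (tnth x i)) j k ^+ 2.
  move=> jS; rewrite -mulrBr.
  under eq_bigr => k _.
    rewrite /shift (additive_coef HM k j gC) jS mul1r exprMn sqr_sqrtr//; over.
  rewrite /= -mulr_sumr ler_pM2l// lerBlDr.
  have := norm_le_coefs HM d (gC j jS) (g1 j jS).
  by rewrite big_mkord.
apply: (@le_trans _ _ (\sum_(j in S)
    (n%:R * dotL2 (unit_interval R) (g j) (g j) - n%:R * mu d))); last exact: ler_sum.
rewrite sumrB -mulr_sumr sumr_const -[X in _ <= _ - X]mulr_natl.
apply: lerB; first by rewrite ler_pM2l.
have [K [_ me]] := model_H0 HM.
apply: ler_pM => //; last exact: truncated_eigenvalue_le.
- by rewrite mulr_ge0// (mercer_ge0 me).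
- by rewrite ler_nat.
Qed.

End Detection.

(** * The constants *)

Section Thresholds.
Context {R : realType}.
Variables (K3 : R) (p s d : nat).
Hypotheses (K3_gt0 : 0 < K3) (s1 : (1 <= s)%N) (sp : (s%:R : R) < Num.sqrt p%:R).
Hypotheses (d0 : (0 < d)%N).
Local Notation L := (log_factor p s : R).
Hypotheses (L_ge : K3 ^+ 2 * d%:R <= L).
Local Notation kappa := (K3 ^- 2).

(** The factor makes d - (d + r^2)/8 <= kappa L - (1 + kappa) L = -L. *)
Definition cutoff_const : R := Num.sqrt (8 * (1 + kappa)).
(** Sum of the bounds of [alpha_le], with ln 2 <= L used to absorb the
constant term. *)
Definition excess_const : R :=
  8 * (8 + 10 * kappa) + 8 / (normal_tail_const * ln 2).

Local Notation r := (cutoff_const * Num.sqrt L).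

Let kappa0 : 0 < kappa. Proof. by rewrite invr_gt0 exprn_gt0. Qed.

Let ln2 : 0 < ln 2 :> R. Proof. by rewrite ln_gt0// ltr1n. Qed.

Let L0 : 0 < L. Proof. exact: lt_le_trans ln2 (log_factor_ge s1 sp). Qed.

Lemma dim_le : d%:R <= kappa * L.
Proof. by rewrite ler_pdivlMl ?exprn_gt0. Qed.

Lemma cutoff_sqr : r ^+ 2 = 8 * (1 + kappa) * L.
Proof.
rewrite exprMn !sqr_sqrtr// ?(ltW L0)// mulr_ge0//.
by rewrite addr_ge0// ltW.
Qed.

Lemma tail_weight_le :
  p%:R * (16 ^+ 2 * expR (d%:R - (d%:R + r ^+ 2) / 8)) <= 16 ^+ 2 * s%:R ^+ 2.
Proof.
rewrite mulrCA ler_pM2l ?exprn_gt0//; apply: le_trans _ (expR_log_factor_le s1 sp).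
rewrite ler_wpM2l// ler_expR cutoff_sqr.
have := dim_le; have := kappa0; have := L0.
have : 0 <= d%:R :> R by [].
set k := kappa; nra.
Qed.

Lemma cutoff_le : d%:R + r ^+ 2 <= excess_const * L.
Proof.
rewrite cutoff_sqr /excess_const.
have c0 : 0 < 8 / (normal_tail_const * ln 2) :> R.
  by rewrite divr_gt0// mulr_gt0 ?normal_tail_const_gt0.
have kL : 0 < kappa * L by rewrite mulr_gt0.
have cL : 0 < 8 / (normal_tail_const * ln 2) * L by rewrite mulr_gt0.
have := dim_le; have := L0.
set k := kappa in kL *; set c := 8 / (normal_tail_const * ln 2) in cL *.
rewrite !mulrDl !mulrDr; lra.
Qed.

Lemma alpha_cutoff_le : alpha r d <= excess_const * L.
Proof.
apply: le_trans (alpha_le r d0) _; rewrite /excess_const [leRHS]mulrDl; apply: lerD.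
  rewrite cutoff_sqr; have := dim_le; have := L0.
  set k := kappa; nra.
have c0 := @normal_tail_const_gt0 R.
have -> : 8 / (normal_tail_const * ln 2) * L = 8 / normal_tail_const * (L / ln 2).
  by field; rewrite !gt_eqF.
rewrite ler_peMr ?divr_ge0 ?(ltW c0)//.
by rewrite ler_pdivlMr// mul1r log_factor_ge.
Qed.

End Thresholds.

(** Chosen for [detection_constP]; 24 kappa / eta is the level, in units of s
L, of the noise energy on the support. *)
Definition detection_const {R : realType} (K3 eta : R) : R :=
  2 * (24 * K3 ^- 2 / eta + excess_const K3 + K3^-1) + 6 +
  3 * 16 ^+ 2 / (eta * ln 2 ^+ 2).

Lemma excess_const_gt0 {R : realType} (K3 : R) : 0 < K3 -> 0 < excess_const K3.
Proof.
move=> K0; apply: addr_gt0.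
  by rewrite mulr_gt0// addr_gt0// mulr_gt0// invr_gt0 exprn_gt0.
by rewrite divr_gt0// mulr_gt0 ?normal_tail_const_gt0// ln_gt0// ltr1n.
Qed.

Lemma detection_const_gt0 {R : realType} (K3 eta : R) : 0 < K3 -> 0 < eta ->
  0 < detection_const K3 eta.
Proof.
move=> K0 eta0; apply: addr_gt0; last first.
  by rewrite divr_gt0// mulr_gt0 ?exprn_gt0// ln_gt0// ltr1n.
apply: addr_gt0 => //; rewrite mulr_gt0//.
apply: addr_gt0; last by rewrite invr_gt0.
apply: addr_gt0; last exact: excess_const_gt0.
by rewrite divr_gt0// mulr_gt0// invr_gt0 exprn_gt0.
Qed.

Lemma detection_constP {R : realType} (K3 eta C : R) : 0 < K3 -> 0 < eta ->
  detection_const K3 eta < C ->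
  [/\ 0 < C, 24 * K3 ^- 2 / eta + excess_const K3 + 2 * C <= (C ^+ 2 - K3^-1) / 2
    & 16 ^+ 2 / (C * ln 2) ^+ 2 <= eta / 3].
Proof.
move=> K0 eta0; rewrite /detection_const.
have M0 : 0 < 24 * K3 ^- 2 / eta.
  by rewrite divr_gt0// mulr_gt0// invr_gt0 exprn_gt0.
have l0 : 0 < ln 2 :> R by rewrite ln_gt0// ltr1n.
have A0 := excess_const_gt0 K0.
have k0 : 0 < K3^-1 by rewrite invr_gt0.
have e0 : 0 < 3 * 16 ^+ 2 / (eta * ln 2 ^+ 2).
  by rewrite divr_gt0// mulr_gt0// exprn_gt0.
move: M0 A0 k0 e0; set M := 24 * _ / _; set A := excess_const _; set k := K3^-1.
set e := 3 * 16 ^+ 2 / _ => M0 A0 k0 e0 CC.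
have C1 : 1 < C by lra.
split; first by lra.
  by rewrite ler_pdivlMr//; nra.
have eC : e <= C ^+ 2 by nra.
have el : e * (eta * ln 2 ^+ 2) = 3 * 16 ^+ 2.
  by rewrite divfK// gt_eqF// mulr_gt0// exprn_gt0.
rewrite ler_pdivrMr ?exprn_gt0 ?mulr_gt0//; last by lra.
rewrite exprMn.
have : e * (eta * ln 2 ^+ 2) <= C ^+ 2 * (eta * ln 2 ^+ 2).
  by rewrite ler_wpM2r// mulr_ge0 ?sqr_ge0// ltW.
rewrite el; lra.
Qed.

(** * Errors of the test in the tail regime *)

Theorem proposition3 (R : realType) (K3 : R) (K3_gt0 : 0 < K3)
    (K3_bulk : bulk_regime K3) :
  exists D K1 K2 : R, [/\ 0 < D, 0 < K1 & 0 < K2] /\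
  forall eta : R, 0 < eta < 1 ->
  exists2 Ceta : R, 0 < Ceta &
  forall (H : set (R -> R)) (ip : (R -> R) -> (R -> R) -> R)
    (mu : nat -> R) (psi : nat -> R -> R),
  rkhs_model H ip mu psi ->
  forall p n s nu : nat,
  (0 < n)%N -> (1 <= s)%N -> (s%:R : R) < Num.sqrt p%:R ->
  is_truncation_level mu p s n nu ->
  let d := maxn nu `|Num.ceil D|%N in
  K3 ^+ 2 * d%:R <= log_factor p s ->
  let tau := Num.sqrt (s%:R * log_factor p s / n%:R) : R in
  let r := K2 * Num.sqrt (log_factor p s) in
  forall (disp : measure_display) (Omega : measurableType disp)
    (P : probability Omega R) (W : (p.-tuple R -> R) -> {RV P >-> R}),
  is_white_noise W ->
  forall C : R, Ceta < C ->
  (testing_error s n H ip psi W r d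
     (C * K1 * n%:R * tau ^+ 2) (C * tau) <= eta%:E)%E.
Proof.
have kappa0 : 0 < K3 ^- 2 by rewrite invr_gt0 exprn_gt0.
exists 1, 1, (cutoff_const K3); split.
  by split=> //; rewrite sqrtr_gt0 mulr_gt0// addr_gt0.
move=> eta /andP[eta0 _].
have ln2_gt0 : 0 < ln 2 :> R by rewrite ln_gt0// ltr1n.
have M0 : 0 < 24 * K3 ^- 2 / eta by rewrite divr_gt0// mulr_gt0.
exists (detection_const K3 eta); first exact: detection_const_gt0.
move=> H ip mu psi HM p n s nu n0 s1 sp lvl d L_ge tau r disp Omega P W WN C CC.
have [C0 Csig Cnull] := detection_constP K3_gt0 eta0 CC.
have nud : (nu <= d)%N by exact: leq_maxl.
have d0 : (0 < d)%N by case: lvl => -[nu0 _] _; exact: leq_trans nu0 nud.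
have nR : 0 < n%:R :> R by rewrite ltr0n.
have sR : 0 < s%:R :> R by rewrite ltr0n.
set L := log_factor p s in L_ge tau r *.
have Lln2 : ln 2 <= L := log_factor_ge s1 sp.
have L0 : 0 < L := lt_le_trans ln2_gt0 Lln2.
have tau2 : n%:R * tau ^+ 2 = s%:R * L.
  rewrite sqr_sqrtr ?divr_ge0 ?mulr_ge0 ?(ltW L0)//.
  by rewrite mulrC divfK// gt_eqF.
set c := C * 1 * n%:R * tau ^+ 2.
have cE : c = C * (s%:R * L) by rewrite /c mulr1 -mulrA tau2.
have c0 : 0 < c by rewrite cE !mulr_gt0.
have tail : p%:R * (16 ^+ 2 * expR (d%:R - (d%:R + r ^+ 2) / 8)) / c ^+ 2 <= eta / 3.
  apply: le_trans Cnull.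
  rewrite ler_pdivrMr ?exprn_gt0// [leRHS]mulrAC ler_pdivlMr ?exprn_gt0 ?mulr_gt0//.
  apply: (@le_trans _ _ (16 ^+ 2 * s%:R ^+ 2 * (C * ln 2) ^+ 2)).
    by rewrite ler_wpM2r ?sqr_ge0//; exact: tail_weight_le.
  rewrite -mulrA ler_pM2l ?exprn_gt0// -exprMn lerXn2r// ?nnegrE; last first.
    by rewrite cE mulrCA ler_pM2l// ler_pM2l.
  - exact: (ltW c0).
  - by rewrite ltW// !mulr_gt0.
(* A third of eta for the null hypothesis; under the alternative, a third for the
   noise off the support and a third for the noise on it. *)
rewrite /testing_error (_ : eta%:E = (eta / 3)%:E + (2 * (eta / 3))%:E)%E; last first.
  by rewrite -EFinD; congr EFin; field.
have mgt : measurable [set x : R | c < x].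
  by have := measurable_itv `]c, +oo[; congr measurable; apply/funext => x /=;
     rewrite in_itv/= andbT.
have mle : measurable [set x : R | x <= c].
  by have := measurable_itv `]-oo, c]; congr measurable; apply/funext => x /=;
     rewrite in_itv.
apply: leeD.
  rewrite (@statistic_law _ _ _ _ _ HM _ _ _ _ _ WN n d r _ [set x | c < x])//.
  have noise0 (j : 'I_p) (k : 'I_d) : shift psi n (fun _ : p.-tuple R => 0) j k = 0 :> R.
    rewrite /shift /dotL2; under eq_Rintegral do rewrite mul0r.
    by rewrite Rintegral_cst// mul0r mulr0.
  by apply: le_trans (gauss_statistic_typeI r d0 c0 noise0) _; rewrite lee_fin.
apply: ge_ereal_sup => _ [->|[f [[S Ss fS] rhof] <-]].
  by rewrite lee_fin mulr_ge0// divr_ge0// ltW.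
rewrite (@statistic_law _ _ _ _ _ HM _ _ _ _ _ WN n d r _ [set x | x <= c])//.
have [sig off] := signal_energy_ge HM K3_gt0 n0 lvl nud L_ge Ss fS
  (mulr_ge0 (ltW C0) (sqrtr_ge0 _)) rhof.
have sL0 : 0 < s%:R * L by rewrite mulr_gt0.
pose m := 24 * K3 ^- 2 / eta * (s%:R * L).
have m0 : 0 < m by rewrite mulr_gt0.
have SsR : #|S|%:R <= s%:R :> R by rewrite ler_nat.
have A0 : 0 < excess_const K3 * L by rewrite mulr_gt0// excess_const_gt0.
have budget : m + #|S|%:R * (excess_const K3 * L) + 2 * c <=
    (\sum_(j in S) \sum_(k < d) shift psi n f j k ^+ 2) / 2.
  have sA : #|S|%:R * (excess_const K3 * L) <= excess_const K3 * (s%:R * L).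
    by rewrite [leRHS]mulrCA ler_wpM2r// ltW.
  move: sig; rewrite exprMn mulrCA tau2 -/L => sig.
  have := ler_wpM2r (ltW sL0) Csig.
  rewrite /m cE; lra.
apply: le_trans (gauss_statistic_typeII d0 (alpha_cutoff_le K3_gt0 s1 sp d0 L_ge)
  (cutoff_le K3_gt0 s1 sp L_ge) c0 m0 off budget) _.
rewrite lee_fin (_ : 2 * (eta / 3) = eta / 3 + eta / 3); last by ring.
apply: lerD => //.
rewrite ler_pdivrMr//.
have -> : eta / 3 * m = s%:R * (8 * (K3 ^- 2 * L)).
  by rewrite /m; field; rewrite !gt_eqF.
apply: ler_pM => //; rewrite ler_pM2l//.
exact: dim_le.
Qed.
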